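(* Let $n,w,k$ be nonnegative integers with $0\le k\le w$. (1) If $0\le k\le w-1$, then \[ |\mathrm{SYT}_{n,2w}[k]| = |\mathrm{MVT}^0_n(w;(1^k,0^{w-k})\to (0^w))|,\quad |\mathrm{SYT}_{n,2w}[2w-k]| = |\mathrm{MVT}^1_n(w;(1^k,0^{w-k})\to (0^w))|, \] \[ |\mathrm{SYT}_{n,2w}[k]|+|\mathrm{SYT}_{n,2w}[2w-k]| = |\mathrm{MVT}^{*}_n(w;(1^k,0^{w-k})\to (0^w))|. \] (2) If $k=w$, then $|\mathrm{SYT}_{n,2w}[w]| = |\mathrm{MVT}^{*}_n(w;(1^w)\to (0^w))|$.
   Context: $\mathrm{SYT}_{n,m}[k]$ is the set of standard Young tableaux with $n$ cells whose shape has at most $m$ columns and exactly $k$ columns of odd length. Partitions with at most $w$ rows are written as $w$-tuples (identified with points $(x_1,\dots,x_w)$ with $x_1\ge\cdots\ge x_w\ge 0$); $(1^k,0^{w-k})$ has $k$ parts equal to $1$, and $\epsilon_i$ denotes the $i$-th standard basis vector of $\mathbb{Z}^w$. A $w$-vacillating tableau of length $n$ from $\mu$ to $\nu$ is a sequence $T=(T_0,\dots,T_n)$ of partitions with at most $w$ rows, $T_0=\mu$, $T_n=\nu$, such that $T_{j-1}$ and $T_j$ differ by at most one cell; equivalently a walk with steps in $\{\vec 0,\pm\epsilon_1,\dots,\pm\epsilon_w\}$, the $j$-th step being $T_j-T_{j-1}$. $\mathrm{VT}_n(w;\mu\to\nu)$ is the set of these; $\mathrm{MVT}_n(w;\mu\to\nu)$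 is the set of pairs $(T,S)$, $T\in\mathrm{VT}_n(w;\mu\to\nu)$, $S\subseteq\{1,\dots,n\}$. $\mathrm{MVT}^*_n(w;\mu\to\nu)$ is the set of $(T,S)\in\mathrm{MVT}_n(w;\mu\to\nu)$ such that $T$ has no zero step and, for every $j\in S$, the $j$-th step of $T$ is $\epsilon_w$ and its starting point $T_{j-1}$ lies on the hyperplane $x_w=0$. $\mathrm{MVT}^0_n(w;\mu\to\nu)$ is the set of $(T,S)\in\mathrm{MVT}^*_n(w;\mu\to\nu)$ such that either $T$ has no $\epsilon_w$ step, or $j\notin S$ where the $j$-th step is the first $\epsilon_w$ step of $T$; $\mathrm{MVT}^1_n(w;\mu\to\nu)$ is the set of $(T,S)\in\mathrm{MVT}^*_n(w;\mu\to\nu)$ such that $T$ has at least one $\epsilon_w$ step and $j\in S$ where the $j$-th step is the first $\epsilon_w$ step of $T$. *)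

(* Defs.v *)
From mathcomp Require Import all_boot all_order all_algebra.
Set Implicit Arguments.
Unset Strict Implicit.
Unset Printing Implicit Defensive.
Import GRing.Theory.

(* A tableau with n cells is a partial filling of the n x n grid (row, column),
   with None outside the shape; a Young diagram with n cells fits in this grid.
   Entries are 0, ..., n-1 instead of 1, ..., n. *)

Definition filling (n : nat) := {ffun 'I_n * 'I_n -> option 'I_n}.

Definition shape (n : nat) (t : filling n) : {set 'I_n * 'I_n} :=
  [set x | t x != None].

Definition is_diagram (n : nat) (D : {set 'I_n * 'I_n}) : bool :=
  [forall x in D, forall y : 'I_n * 'I_n,
     (y.1 <= x.1) && (y.2 <= x.2) ==> (y \in D)].

Definition entry_lt (n : nat) (t : filling n) (x y : 'I_n * 'I_n) : bool :=
  if (t x, t y) is (Some a, Some b) then a < b else true.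

Definition is_syt (n : nat) (t : filling n) : bool :=
  [&& is_diagram (shape t),
      [forall e : 'I_n, #|[set x | t x == Some e]| == 1],
      [forall r : 'I_n, forall c : 'I_n, forall d : 'I_n,
         (c < d) ==> entry_lt t (r, c) (r, d)] &
      [forall c : 'I_n, forall r : 'I_n, forall s : 'I_n,
         (r < s) ==> entry_lt t (r, c) (s, c)]].

Definition col_length (n : nat) (D : {set 'I_n * 'I_n}) (c : 'I_n) : nat :=
  #|[set r | (r, c) \in D]|.

Definition num_cols (n : nat) (D : {set 'I_n * 'I_n}) : nat :=
  #|[set c | 0 < col_length D c]|.

Definition num_odd_cols (n : nat) (D : {set 'I_n * 'I_n}) : nat :=
  #|[set c | odd (col_length D c)]|.

Definition SYT (n m k : nat) : {set filling n} :=
  [set t | [&& is_syt t, num_cols (shape t) <= m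
             & num_odd_cols (shape t) == k]].

(* Partitions with at most w rows are row vectors of naturals. *)

Definition is_partition (w : nat) (p : 'rV[nat]_w) : bool :=
  [forall a : 'I_w, forall b : 'I_w, (a <= b) ==> (p ord0 b <= p ord0 a)].

Definition ones (w k : nat) : 'rV[nat]_w := \row_(i < w) (if i < k then 1 else 0).

Section Walks.
Variables (n w : nat).

Definition eps (i : 'I_w) : 'rV[int]_w := delta_mx ord0 i.

(* The step of index j : 'I_n goes from T_j to T_(j+1); it is the (j+1)-st step
   in 1-based numbering. *)
Definition step_src (j : 'I_n) : 'I_n.+1 := widen_ord (leqnSn n) j.
Definition step_tgt (j : 'I_n) : 'I_n.+1 := lift ord0 j.

Implicit Types (T : 'I_n.+1 -> 'rV[nat]_w) (S : {set 'I_n}) (mu nu : 'rV[nat]_w).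

Definition step T (j : 'I_n) : 'rV[int]_w :=
  (map_mx Posz (T (step_tgt j)) - map_mx Posz (T (step_src j)))%R.

Definition allowed_step (v : 'rV[int]_w) : bool :=
  (v == 0)%R || [exists i : 'I_w, (v == eps i) || (v == - eps i)%R].

Definition is_vt mu nu T : bool :=
  [&& [forall j, is_partition (T j)], T ord0 == mu, T ord_max == nu
    & [forall j, allowed_step (step T j)]].

(* The index i with i.+1 = w is the last coordinate; there is none if w = 0. *)
Definition eps_w_step T (j : 'I_n) : bool :=
  [exists i : 'I_w, (i.+1 == w) && (step T j == eps i)].

Definition on_wall (p : 'rV[nat]_w) : bool :=
  [exists i : 'I_w, (i.+1 == w) && (p ord0 i == 0)].

Definition starred T S : bool :=
  [forall j, step T j != 0%R] &&
  [forall j in S, eps_w_step T j && on_wall (T (step_src j))].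

Definition first_eps_w_step T (j : 'I_n) : bool :=
  eps_w_step T j && [forall i : 'I_n, (i < j) ==> ~~ eps_w_step T i].

(* Finite carrier for sequences starting at mu: by [is_vt_bounded] below, every
   vacillating tableau of length n from mu has all its parts at most
   [vt_bound mu], so restricting to this range loses nothing. *)
Definition vt_bound mu : nat := \max_(i < w) mu ord0 i + n.

Definition vt_seq mu := {ffun 'I_n.+1 -> 'rV['I_(vt_bound mu).+1]_w}.

Definition nat_seq mu (T : vt_seq mu) : 'I_n.+1 -> 'rV[nat]_w :=
  fun j => map_mx (@nat_of_ord _) (T j).

Definition VT mu nu : {set vt_seq mu} := [set T | is_vt mu nu (nat_seq T)].

Definition MVT mu nu : {set vt_seq mu * {set 'I_n}} :=
  [set P | P.1 \in VT mu nu].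

Definition MVTstar mu nu : {set vt_seq mu * {set 'I_n}} :=
  [set P in MVT mu nu | starred (nat_seq P.1) P.2].

Definition MVT0 mu nu : {set vt_seq mu * {set 'I_n}} :=
  [set P in MVTstar mu nu |
    [forall j, ~~ eps_w_step (nat_seq P.1) j]
    || [exists j, first_eps_w_step (nat_seq P.1) j && (j \notin P.2)]].

Definition MVT1 mu nu : {set vt_seq mu * {set 'I_n}} :=
  [set P in MVTstar mu nu |
    [exists j, first_eps_w_step (nat_seq P.1) j && (j \in P.2)]].

Lemma is_vt_bounded mu nu T (j : 'I_n.+1) (i : 'I_w) :
  is_vt mu nu T -> T j ord0 i <= vt_bound mu.
Proof.
case/and4P=> _ /eqP T0 _ /forallP Tst.
suff H : forall m (lt_mn : m < n.+1), T (Ordinal lt_mn) ord0 i <= mu ord0 i + m.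
  case: j => m ltm; apply: leq_trans (H m ltm) _.
  by apply: leq_add; [exact: (leq_bigmax (F := fun i => mu ord0 i)) | rewrite -ltnS].
elim=> [|m IHm] ltm.
  by rewrite (_ : Ordinal ltm = ord0) ?T0 ?addn0 //; apply: val_inj.
have ltmn : m < n by [].
have {IHm} := IHm (ltnW ltm); have := Tst (Ordinal ltmn).
rewrite /allowed_step /step.
rewrite (_ : step_src _ = Ordinal (ltnW ltm)); last exact: val_inj.
rewrite (_ : step_tgt _ = Ordinal ltm); last exact: val_inj.
set a := T (Ordinal ltm); set b := T _ => st le_b.
suff le_ab : (Posz (a ord0 i) <= Posz (b ord0 i) + 1)%R.
  have le_ab' : a ord0 i <= b ord0 i + 1 by rewrite -lez_nat PoszD.
  by apply: leq_trans le_ab' _; rewrite addn1 addnS ltnS.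
rewrite addrC -Num.Theory.lerBlDr.
have eE (v : 'rV[int]_w) : (map_mx Posz a - map_mx Posz b)%R = v ->
    (Posz (a ord0 i) - Posz (b ord0 i))%R = v ord0 i.
  by move=> <-; rewrite !mxE.
case/orP: st => [/eqP/eE-> | /existsP[l /orP[] /eqP/eE->]]; rewrite !mxE //;
  by rewrite eqxx /=; case: (i == l).
Qed.

End Walks.

Arguments SYT : clear implicits.
Arguments VT : clear implicits.
Arguments MVT : clear implicits.
Arguments MVTstar : clear implicits.
Arguments MVT0 : clear implicits.
Arguments MVT1 : clear implicits.

(* Main.v *)
(* Both sides are read off one sum of alternants over roots of unity, a discrete
   form of integration over a maximal torus of O(2w) or Sp(2w-2).  Let X_i run over
   odd powers of a root of unity of large order, put y_i = X_i + 1/X_i, and let [ev]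
   list the X_i and 1/X_i, followed by nothing (orthogonal case, v = w) or by 1, -1
   (symplectic case, v = w - 1).  Consider the sum over the X_i of
     (sum ev)^n  prod (1 + t ev)  det(ev^(m-1), ..., ev, 1) / prod (X_i - 1/X_i).
   Multiplying an alternant by [sum ev] adds a cell to a partition with 2w parts, and
   the remaining sums vanish unless all parts have the same parity, so the sum counts
   tableaux by the number of odd columns: the coefficient of t^k is
   |SYT[k]| +- |SYT[2w-k]| up to a constant.  On the other hand the Vandermonde
   determinant equals prod (X_i - 1/X_i) times the square of the Vandermonde
   determinant in the y_i times a weight, and in terms of the orthogonal polynomials
   for this weight multiplication by [sum y_i] is one step of a walk of partitions, so
   the same sum counts walks from (1^k) to 0, with weight 2 at the wall in the
   orthogonal case.  Adding and subtracting the two identities gives MVT* and MVT^0. *)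

Require Import Defs.
From mathcomp Require Import all_boot all_order all_fingroup all_algebra all_field.
From mathcomp Require Import zify ring.
Set Implicit Arguments.
Unset Strict Implicit.
Unset Printing Implicit Defensive.
Import GRing.Theory.
Local Open Scope ring_scope.

(** * Determinants *)

Section Determinants.
Variable K : comNzRingType.

Lemma det_cols n (M : 'M[K]_n) :
  \det M = \sum_(s : 'S_n) (-1) ^+ s * \prod_j M (s j) j.
Proof.
rewrite -det_tr; apply: eq_bigr => s _; congr (_ * _).
by apply: eq_bigr => j _; rewrite mxE.
Qed.

Lemma det_eq_col n (M : 'M[K]_n) (a b : 'I_n) :
  a != b -> (forall i, M i a = M i b) -> \det M = 0.
Proof.
move=> ab eqM; rewrite -det_tr; apply: (determinant_alternate ab) => j.
by rewrite !mxE.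
Qed.

(** A Leibniz term meets every row once, so the factor [\sum_i z i] splits into the [z (s j)] over
    the columns [j]. For alternants this becomes the rule for adding one cell. *)
Lemma det_scale_col_sum n (M : 'M[K]_n) (z : 'I_n -> K) :
  (\sum_i z i) * \det M =
  \sum_j \det (\matrix_(i, k) (if k == j then z i * M i k else M i k)).
Proof.
rewrite det_cols mulr_sumr; under [RHS]eq_bigr => j _ do rewrite det_cols.
rewrite exchange_big; apply: eq_bigr => s _; rewrite -mulr_sumr mulrCA; congr (_ * _).
rewrite (reindex_inj (@perm_inj _ s)) /= mulr_suml; apply: eq_bigr => j _.
rewrite [RHS](bigD1 j) //= mxE eqxx (bigD1 j) //= mulrA; congr (_ * _).
by apply: eq_bigr => k /negPf kj; rewrite mxE kj.
Qed.

Lemma det_col_linear n (M : 'M[K]_n) (j : 'I_n) (U V : 'I_n -> K) (c : K) :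
  \det (\matrix_(i, k) (if k == j then U i + c * V i else M i k)) =
  \det (\matrix_(i, k) (if k == j then U i else M i k)) +
  c * \det (\matrix_(i, k) (if k == j then V i else M i k)).
Proof.
rewrite !det_cols mulr_sumr -big_split; apply: eq_bigr => s _ /=.
rewrite mulrCA -mulrDr; congr (_ * _).
rewrite !(bigD1 (P := predT) j) //= !mxE eqxx mulrDl mulrA; congr (_ * _ + _ * _);
  by apply: eq_bigr => k /negPf kj; rewrite !mxE kj.
Qed.

Lemma det_cols_add n (P Q : 'M[K]_n) :
  \det (P + Q) =
  \sum_(A : {set 'I_n}) \det (\matrix_(i, j) (if j \in A then Q i j else P i j)).
Proof.
rewrite det_cols; under [RHS]eq_bigr => A _ do rewrite det_cols.
rewrite exchange_big; apply: eq_bigr => s _; rewrite -mulr_sumr; congr (_ * _).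
under eq_bigr => j _ do rewrite mxE addrC.
rewrite bigA_distr; apply: eq_bigr => A _; apply: eq_bigr => j _.
by rewrite mxE.
Qed.

Lemma det_row_scale n (M : 'M[K]_n) (z : 'I_n -> K) :
  \det (\matrix_(i, j) (z i * M i j)) = (\prod_i z i) * \det M.
Proof.
rewrite /determinant mulr_sumr; apply: eq_bigr => s _; rewrite mulrCA; congr (_ * _).
by rewrite -big_split; apply: eq_bigr => i _; rewrite mxE.
Qed.

(** Defined on sequences, since the points are later concatenated from the [X_i], their inverses and
    the fixed points. *)
Fixpoint vdm (s : seq K) : K :=
  if s is a :: s' then (\prod_(b <- s') (a - b)) * vdm s' else 1.

Lemma vdm_prod s :
  vdm s = \prod_(i < size s) \prod_(j < size s | (i < j)%N) (s`_i - s`_j).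
Proof.
elim: s => [|a s IHs] /=; first by rewrite big_ord0.
rewrite big_ord_recl IHs; congr (_ * _).
  rewrite (big_nth 0) big_mkord [RHS]big_mkcond big_ord_recl /= mul1r.
  by apply: eq_bigr.
by apply: eq_bigr => i _; rewrite [RHS]big_mkcond big_ord_recl /= mul1r -big_mkcond.
Qed.

Lemma vdm_cat s t :
  vdm (s ++ t) = vdm s * vdm t * \prod_(a <- s) \prod_(b <- t) (a - b).
Proof.
elim: s => [|a s IHs] /=; first by rewrite big_nil mulr1 mul1r.
by rewrite IHs big_cat big_cons /=; ring.
Qed.

(** Monic polynomials of degrees [0, 1, ...] give a Vandermonde matrix times a unitriangular one. So
    powers and orthogonal polynomials have the same alternant at the staircase. *)
Lemma det_monic_alternant n (b : nat -> {poly K}) (s : seq K) :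
  (forall c, b c \is monic) -> (forall c, size (b c) = c.+1) -> size s = n ->
  \det (\matrix_(i < n, j < n) (b (n.-1 - j)%N).[s`_i]) = vdm s.
Proof.
(* [Vandermonde] has increasing exponents and factors [a_j - a_i] for [i < j]; rows and columns are
   both reversed, so the two signs cancel. *)
move=> bm bs sn; pose y : 'rV[K]_n := \row_i s`_(n.-1 - i)%N.
have -> : \matrix_(i < n, j < n) (b (n.-1 - j)%N).[s`_i] =
    row_perm (perm (@rev_ord_inj n)) (col_perm (perm (@rev_ord_inj n))
      ((Vandermonde n y)^T *m \matrix_(k < n, j < n) (b j)`_k)).
  apply/matrixP => i j; rewrite !mxE !permE /=.
  have nj : (n - j.+1 < n)%N by have := ltn_ord j; lia.
  have -> : (n.-1 - j = n - j.+1)%N by lia.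
  rewrite (horner_coef_wide _ (_ : _ <= n)%N) ?bs //.
  apply: eq_bigr => k _; rewrite !mxE /= mulrC; congr (_ ^+ _ * _); congr (_`_ _).
  by have := ltn_ord i; lia.
rewrite row_permE col_permE !det_mulmx !det_perm mulrCA !mulrA odd_permV.
rewrite -(mulrA _ ((-1) ^+ _)) -expr2 sqrr_sign mulr1.
rewrite det_tr det_Vandermonde -[X in _ * X]det_tr det_trig; last first.
  apply/is_trig_mxP => i j ij; rewrite !mxE nth_default // bs; exact: ij.
rewrite [X in _ * X]big1 ?mulr1; last first.
  by move=> i _; have /monicP := bm i; rewrite !mxE /lead_coef bs.
rewrite vdm_prod sn.
rewrite (exchange_big_dep predT) //= (reindex_inj (@rev_ord_inj n)) /=.
apply: eq_bigr => i _; rewrite (reindex_inj (@rev_ord_inj n)) /=.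
apply: eq_big => [j|j _]; first by have := ltn_ord i; have := ltn_ord j; lia.
rewrite !mxE /=; congr (_`_ _ - _`_ _); have := ltn_ord i; have := ltn_ord j; lia.
Qed.

End Determinants.

(** * Sums over odd powers of a root of unity *)

Section RootSums.
Variables (K : numFieldType) (N : nat) (z : K).
Hypotheses (zP : (2 * N).-primitive_root z) (evenN : ~~ odd N).

(* Restricting to odd powers keeps [rt - rt^-1] away from [0], as [N] is even. *)
Definition rt (x : 'I_N) : K := z ^+ (2 * x).+1.

Lemma rt_neq0 x : rt x != 0.
Proof.
rewrite expf_eq0 /=; apply/eqP => z0; have /eqP := prim_expr_order zP.
by rewrite z0 expr0n muln_eq0 /= eqn0Ngt (leq_trans _ (ltn_ord x)) // eq_sym oner_eq0.
Qed.

Lemma rt_diff_neq0 x : rt x - (rt x)^-1 != 0.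
Proof.
have nz := rt_neq0 x; rewrite subr_eq0; apply/eqP => eqx.
have : rt x ^+ 2 = 1 by rewrite expr2 {1}eqx mulVf.
rewrite -exprM => /eqP; rewrite -(prim_order_dvd zP) => dv.
have : (2 * N %| 2 * (2 * x).+1)%N by rewrite mulnC in dv; rewrite (mulnC 2 (2 * x).+1) mulnC.
rewrite dvdn_pmul2l // => /dvdnP [q] eqq.
by have := congr1 odd eqq; rewrite oddM (negPf evenN) andbF /= oddM.
Qed.

(** The exponents of [x] and [rev_ord x] add up to [2 * N]. Reindexing by [rev_ord] is thus the
    substitution of [1/X] for [X]. *)
Lemma rt_rev x : rt (rev_ord x) = (rt x)^-1.
Proof.
apply: (mulfI (rt_neq0 x)); rewrite divff ?rt_neq0 // -exprD -(prim_expr_order zP).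
by congr (_ ^+ _); have := ltn_ord x => /=; lia.
Qed.

Lemma sum_rt_pos d : (0 < d < N)%N -> \sum_x rt x ^+ d = 0.
Proof.
move=> dN; pose q := z ^+ (2 * d).
have -> : \sum_x rt x ^+ d = z ^+ d * \sum_(x < N) q ^+ x.
  rewrite mulr_sumr; apply: eq_bigr => x _; rewrite -!exprM -exprD.
  by congr (_ ^+ _); lia.
have q1 : q - 1 != 0.
  rewrite subr_eq0 -(prim_order_dvd zP) dvdn_pmul2l //.
  by apply/negP => /dvdn_leq; lia.
suff -> : \sum_(x < N) q ^+ x = 0 by rewrite mulr0.
apply: (mulfI q1); rewrite -subrX1 mulr0 -exprM.
by rewrite -mulnA (mulnC d) mulnA exprM (prim_expr_order zP) expr1n subrr.
Qed.

Lemma sum_rt c d : (c < d + N)%N -> (d < c + N)%N ->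
  \sum_x rt x ^+ c * (rt x)^-1 ^+ d = if c == d then N%:R else 0.
Proof.
have cancel x k : rt x ^+ k * (rt x)^-1 ^+ k = 1.
  by rewrite -exprMn divff ?expr1n ?rt_neq0.
case: (ltngtP c d) => /= [cd|cd|->] h1 h2.
- rewrite (reindex_inj rev_ord_inj) /= -[RHS](@sum_rt_pos (d - c)); last by lia.
  apply: eq_bigr => x _; rewrite rt_rev invrK -{1}(subnK (ltnW cd)) exprD mulrCA.
  by rewrite (mulrC (_ ^-1 ^+ c)) cancel mulr1.
- rewrite -[RHS](@sum_rt_pos (c - d)); last by lia.
  apply: eq_bigr => x _; rewrite -{1}(subnK (ltnW cd)) exprD -mulrA.
  by rewrite cancel mulr1.
- by under eq_bigr => x _ do rewrite cancel; rewrite sumr_const card_ord.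
Qed.

(** An alternant puts one exponent on [X] and another on [1/X]; after division by [X - 1/X], summing
    over [X] yields this antisymmetric pairing. *)
Definition skew_sum (c d : nat) : K :=
  \sum_x rt x ^+ c * (rt x)^-1 ^+ d / (rt x - (rt x)^-1).

Lemma skew_sum_anti c d : skew_sum d c = - skew_sum c d.
Proof.
rewrite /skew_sum (reindex_inj rev_ord_inj) /= -sumrN; apply: eq_bigr => x _.
by rewrite rt_rev invrK -(opprB (rt x)) invrN mulrN (mulrC (_ ^+ d)).
Qed.

Lemma skew_sumSS c d : skew_sum c.+1 d.+1 = skew_sum c d.
Proof.
apply: eq_bigr => x _; rewrite !exprS; congr (_ / _).
by rewrite mulrACA divff ?rt_neq0 // mul1r.
Qed.

Lemma skew_sum_step c d :
  skew_sum c.+1 d - skew_sum c d.+1 = \sum_x rt x ^+ c * (rt x)^-1 ^+ d.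
Proof.
rewrite -sumrB; apply: eq_bigr => x _; rewrite -mulrBl !exprS.
rewrite -mulrA (mulrCA _ (_^-1)) -mulrBl mulrC mulKf //; exact: rt_diff_neq0.
Qed.

(** Raising [k] by two changes the sum by the sum of the [X^(k+1)], which vanishes, so only the
    parity counts. Antisymmetry gives the values at 0 and 1. *)
Lemma skew_sum_diff k : (k < N)%N -> skew_sum k 0 = (odd k)%:R * (N%:R / 2).
Proof.
elim/ltn_ind: k => -[|[|k]] IH kN.
- rewrite mul0r; apply/eqP.
  have /eqP := skew_sum_anti 0 0; rewrite -addr_eq0 -mulr2n -mulr_natr mulf_eq0.
  by rewrite Num.Theory.pnatr_eq0 orbF.
- rewrite mul1r; have := skew_sum_step 0 0; rewrite sum_rt //=; try lia.
  rewrite (skew_sum_anti 1) opprK -mulr2n => <-.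
  by rewrite -[X in _ = X / _]mulr_natr mulfK // Num.Theory.pnatr_eq0.
- rewrite /= negbK -IH //; last by lia.
  have := skew_sum_step k.+1 0; rewrite sum_rt //=; try lia.
  by move/eqP; rewrite skew_sumSS subr_eq0 => /eqP.
Qed.

(** The pairing sees only the parities and the relative order of its arguments; the cancellations
    among alternant sums rest on this. *)
Lemma skew_sumE c d : (c < N)%N -> (d < N)%N ->
  skew_sum c d =
  if odd c == odd d then 0 else if (d < c)%N then N%:R / 2 else - (N%:R / 2).
Proof.
have shift k e : skew_sum (k + e) e = skew_sum k 0.
  by elim: e => [|e IHe]; rewrite ?addn0 // addnS skew_sumSS.
have gt a b : (b <= a)%N -> (a < N)%N ->
    skew_sum a b = (odd a != odd b)%:R * (N%:R / 2).
  move=> ba aN; rewrite -{1}(subnK ba) shift skew_sum_diff; last by lia.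
  by rewrite oddB // -negb_eqb.
move=> cN dN; case: ltnP => dc.
  by rewrite gt ?(ltnW dc) //; case: eqP => _; rewrite ?mul0r ?mul1r.
rewrite skew_sum_anti gt // eq_sym.
by case: eqP => _; rewrite ?mul0r ?mul1r ?oppr0.
Qed.

End RootSums.

(** * Partitions as row vectors *)

Section Partitions.
Variable v : nat.
Implicit Types (mu : 'rV[nat]_v) (i j : 'I_v).

(** The staircase turns weakly decreasing parts into strictly decreasing exponents. *)
Definition shifted mu j : nat := (mu ord0 j + (v.-1 - j))%N.
Definition add_cell mu j : 'rV[nat]_v := \row_i (mu ord0 i + (i == j))%N.
Definition del_cell mu j : 'rV[nat]_v := \row_i (mu ord0 i - (i == j))%N.

Lemma partitionP mu :
  reflect (forall i j, (i <= j)%N -> (mu ord0 j <= mu ord0 i)%N) (is_partition mu).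
Proof.
apply: (iffP forallP) => [H i j ij | H i].
  by have /forallP/(_ j)/implyP/(_ ij) := H i.
by apply/forallP => j; apply/implyP/H.
Qed.

(** The failure can only come from a tie with the preceding part. After the addition the two shifted
    parts coincide, so the alternant vanishes. *)
Lemma add_cell_not_partition mu j :
  is_partition mu -> ~~ is_partition (add_cell mu j) ->
  exists i, [/\ i.+1 = j & mu ord0 i = mu ord0 j].
Proof.
move/partitionP => pm np.
have j0 : (0 < j)%N.
  rewrite lt0n; apply: contra np => /eqP j0; apply/partitionP => a b ab.
  rewrite !mxE; have := pm a b ab.
  case: (b =P j) => [bj|_]; case: (a =P j) => [aj|aj]; try lia.
  suff : val a = val j by move/val_inj.
  by move: ab; rewrite bj /=; lia.
have ij : (j.-1 < v)%N by have := ltn_ord j; lia.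
exists (Ordinal ij); split; first by rewrite /=; lia.
apply/eqP; rewrite eqn_leq (pm _ j) /= ?leq_pred // andbT.
apply: contraR np; rewrite -ltnNge => lt; apply/partitionP => a b ab.
rewrite !mxE; have := pm a b ab.
case: (b =P j) => [bj|_]; case: (a =P j) => [aj|aj]; rewrite ?addn0; try lia.
move=> _; rewrite bj addn1; apply: leq_trans lt _; apply: pm => /=.
rewrite bj leq_eqVlt in ab; case/orP: ab => [/eqP/val_inj //|]; lia.
Qed.

Lemma del_cell_not_partition mu j :
  is_partition mu -> ~~ is_partition (del_cell mu j) ->
  exists i, [/\ i = j.+1 :> nat & mu ord0 i = mu ord0 j].
Proof.
move/partitionP => pm np.
have j1 : (j.+1 < v)%N.
  rewrite ltnNge; apply: contra np => jv; apply/partitionP => a b ab.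
  rewrite !mxE; have := pm a b ab.
  case: (b =P j) => [bj|bj]; case: (a =P j) => [aj|aj]; rewrite ?subn0; try lia.
  suff : val b = val j by move/val_inj.
  by move: ab; rewrite aj /=; have := ltn_ord b; lia.
exists (Ordinal j1); split=> //.
apply/eqP; rewrite eqn_leq (pm j) //= .
apply: contraR np; rewrite -ltnNge => lt; apply/partitionP => a b ab.
rewrite !mxE; have := pm a b ab.
case: (b =P j) => [bj|bj]; case: (a =P j) => [aj|aj]; rewrite ?subn0; try lia.
move=> _; rewrite aj subn1 -ltnS; apply: leq_ltn_trans (_ : (mu ord0 (Ordinal j1) < _)%N).
  apply: pm => /=; rewrite aj leq_eqVlt in ab.
  by case/orP: ab => [/eqP/val_inj/esym|].
by apply: leq_trans lt _; lia.
Qed.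

Lemma shifted_add_cell mu i j : shifted (add_cell mu j) i = (shifted mu i + (i == j))%N.
Proof. by rewrite /shifted mxE addnAC. Qed.

End Partitions.

Definition odd_set m (la : 'rV[nat]_m) : {set 'I_m} := [set j | odd (la ord0 j)].

(** The parts of [la] stand for column lengths: each step lengthens one column, and at the end [k]
    columns must be odd. *)
Fixpoint add_count n m (la : 'rV[nat]_m) k : nat :=
  if n is n'.+1 then
    (\sum_(j | is_partition (add_cell la j)) add_count n' (add_cell la j) k)%N
  else (#|odd_set la| == k).

(** * Sums of alternants *)

Lemma expr_parity (K : pzRingType) (a : K) n : a ^+ 2 = 1 -> a ^+ n = a ^+ odd n.
Proof.
by move=> a2; rewrite -{1}(odd_double_half n) exprD -muln2 mulnC exprM a2 expr1n mulr1.
Qed.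

Section AlternantSums.
Variables (K : numFieldType) (N : nat) (z : K).
Hypotheses (zP : (2 * N).-primitive_root z) (evenN : ~~ odd N).
Variables (v : nat) (g : seq K).
Hypothesis gP : forall a, a \in g -> a ^+ 2 = 1.
Local Notation m := (v + v + size g)%N.
Local Notation skew := (skew_sum N z).

Definition pts (x : {ffun 'I_v -> 'I_N}) : seq K := [seq rt z (x i) | i <- enum 'I_v].

Lemma size_pts x : size (pts x) = v.
Proof. by rewrite size_map size_enum_ord. Qed.

Lemma nth_pts x (i : 'I_v) : (pts x)`_i = rt z (x i).
Proof. by rewrite (nth_map i) ?size_enum_ord // nth_ord_enum. Qed.

Definition evs (s : seq K) : seq K := (s ++ [seq a^-1 | a <- s]) ++ g.

Lemma prod_evs (s : seq K) (f : 'I_m -> K -> K) : size s = v ->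
  \prod_i f i (evs s)`_i =
  (\prod_(i < v) (f (lshift _ (lshift _ i)) s`_i * f (lshift _ (rshift _ i)) (s`_i)^-1))
  * \prod_(r < size g) f (rshift _ r) g`_r.
Proof.
move=> sv; rewrite !big_split_ord /= big_split /=.
have sz : size (s ++ [seq a^-1 | a <- s]) = (v + v)%N by rewrite size_cat size_map sv.
congr (_ * _ * _); apply: eq_bigr => i _.
- by rewrite /evs nth_cat sz ltn_addr // nth_cat sv ltn_ord.
- rewrite /evs nth_cat sz ltn_add2l ltn_ord nth_cat sv ltnNge leq_addr /= addKn.
  by rewrite (nth_map 0) ?sv.
- by rewrite /evs nth_cat sz ltnNge leq_addr /= addKn.
Qed.

Definition disc (x : {ffun 'I_v -> 'I_N}) : K :=
  \prod_i (rt z (x i) - (rt z (x i))^-1).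

Definition alternant (c : 'I_m -> nat) x : K :=
  \det (\matrix_(i, j) (evs (pts x))`_i ^+ c j).

Definition alt_sum (c : 'I_m -> nat) : K := \sum_x alternant c x / disc x.

Lemma eq_alternant c c' x : c =1 c' -> alternant c x = alternant c' x.
Proof. by move=> cc; congr (\det _); apply/matrixP => i j; rewrite !mxE cc. Qed.

Lemma alternant_eq0 c x (i j : 'I_m) : i != j -> c i = c j -> alternant c x = 0.
Proof. by move=> ij cij; apply: (det_eq_col ij) => k; rewrite !mxE cij. Qed.

(** In a Leibniz term the powers of [X_i] and [1/X_i] involve only [x i], so the sum over [x]
    factors into pairings, times a constant from [g]. *)
Lemma alt_sumE c : alt_sum c =
  \sum_(s : 'S_m) (-1) ^+ s *
    ((\prod_(i < v) skew (c (s (lshift _ (lshift _ i)))) (c (s (lshift _ (rshift _ i)))))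
     * \prod_(r < size g) g`_r ^+ c (s (rshift _ r))).
Proof.
transitivity (\sum_(s : 'S_m) \sum_(x : {ffun 'I_v -> 'I_N}) (-1) ^+ s *
   ((\prod_(i < v) (rt z (x i) ^+ (c (s (lshift _ (lshift _ i))))
    * (rt z (x i))^-1 ^+ (c (s (lshift _ (rshift _ i)))) / (rt z (x i) - (rt z (x i))^-1)))
     * \prod_(r < size g) g`_r ^+ c (s (rshift _ r)))).
  rewrite exchange_big; apply: eq_bigr => x _; rewrite /alternant mulr_suml.
  apply: eq_bigr => s _.
  under eq_bigr => i _ do rewrite mxE.
  rewrite (prod_evs (fun i a => a ^+ c (s i))) ?size_pts //.
  rewrite -!mulrA; congr (_ * _); rewrite mulrCA [RHS]mulrC; congr (_ * _).
  rewrite /disc -prodf_div; apply: eq_bigr => i _; by rewrite nth_pts.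
apply: eq_bigr => s _; rewrite -mulr_sumr -mulr_suml; congr (_ * (_ * _)).
by rewrite [RHS]bigA_distr_bigA.
Qed.

(** Composing with the transposition flips the sign of each term of [alt_sumE] and keeps the rest:
    the pairings by hypothesis, the powers of points of [g] because they depend on parity only. The
    sum is its own negative. *)
Lemma alt_sum_swap_eq0 c (i j : 'I_m) : i != j ->
  (forall a b, a != b -> skew (c (tperm i j a)) (c (tperm i j b)) = skew (c a) (c b)) ->
  (forall a, odd (c (tperm i j a)) = odd (c a)) ->
  alt_sum c = 0.
Proof.
move=> ij sk od; suff /eqP : alt_sum c = - alt_sum c.
  by rewrite -addr_eq0 -mulr2n -mulr_natr mulf_eq0 Num.Theory.pnatr_eq0 orbF => /eqP.
rewrite {1}alt_sumE (reindex_inj (mulIg (tperm i j))) alt_sumE -sumrN.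
apply: eq_bigr => s _; rewrite odd_permM odd_tperm ij addbT -mulNr.
congr (_ * (_ * _)); first by case: (s : bool); rewrite ?expr1 ?expr0 ?opprK.
  apply: eq_bigr => a _; rewrite !permM sk // (inj_eq perm_inj).
  by rewrite (inj_eq (@lshift_inj _ _)) eq_lrshift.
apply: eq_bigr => r _; have g2 := gP (mem_nth 0 (ltn_ord r)).
by rewrite permM (expr_parity _ g2) [RHS](expr_parity _ g2) od.
Qed.

End AlternantSums.

Lemma adjacent_constant (T : Type) m (p : 'I_m -> T) :
  (forall i j : 'I_m, j = i.+1 :> nat -> p i = p j) -> forall i j, p i = p j.
Proof.
move=> adj; suff le (d : nat) (i j : 'I_m) : j = (i + d)%N :> nat -> p i = p j.
  move=> i j; case: (leqP i j) => ij; first by apply: (le (j - i)%N); rewrite subnKC.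
  by apply/esym/(le (i - j)%N); rewrite subnKC // ltnW.
elim: d j => [|d IHd] j jE.
  by congr p; apply: val_inj; rewrite /= jE addn0.
have jm : (i + d < m)%N by have := ltn_ord j; lia.
by rewrite (IHd (Ordinal jm)) //; apply: adj => /=; rewrite jE addnS.
Qed.

(** * Pieri rules for alternants and the parity of columns *)

Section AdditionCount.
Variables (K : numFieldType) (N : nat) (z : K).
Hypotheses (zP : (2 * N).-primitive_root z) (evenN : ~~ odd N).
Variables (v : nat) (g : seq K).
Hypothesis gP : forall a, a \in g -> a ^+ 2 = 1.
Local Notation m := (v + v + size g)%N.
Hypothesis m_gt0 : (0 < m)%N.
Local Notation skew := (skew_sum N z).
Local Notation alternant := (@alternant K N z v g).
Local Notation alt_sum := (@alt_sum K N z v g).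
Local Notation disc := (@disc K N z v).
Implicit Types (la : 'rV[nat]_m) (A : {set 'I_m}).

Definition alt_const : K := alt_sum (fun j => m.-1 - j)%N.

Lemma skew_eq c d c' d' : [/\ c < N, d < N, c' < N & d' < N]%N ->
  (odd c == odd d) = (odd c' == odd d') ->
  (odd c != odd d -> (d < c)%N = (d' < c')%N) -> skew c d = skew c' d'.
Proof.
case=> cN dN cN' dN' par lt; rewrite !skew_sumE // -par.
by case: eqP lt => // _ ->.
Qed.

Lemma odd_shift la A j :
  odd (shifted la j + (j \in A)) = odd (la ord0 j) (+) (j \in A) (+) odd (m.-1 - j).
Proof. by rewrite /shifted !oddD oddb addbAC. Qed.

(** Relative to the staircase all parities shift by the same [e] and the order is kept, so every
    pairing is unchanged; only the points of [g] notice, each contributing [a ^+ e]. *)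
Lemma alt_sum_const_parity la A (e : bool) : is_partition la ->
  (forall j, shifted la j + 1 < N)%N -> (forall j, odd (la ord0 j) (+) (j \in A) = e) ->
  alt_sum (fun j => shifted la j + (j \in A))%N = alt_const * (\prod_(a <- g) a) ^+ e.
Proof.
move/partitionP => pl bd pe.
(* By the parity condition, equal parts are both in [A] or both outside, so adding [A] creates no
   tie. *)
have lt (a b : 'I_m) : (a < b)%N ->
    (shifted la b + (b \in A) < shifted la a + (a \in A))%N /\ (m.-1 - b < m.-1 - a)%N.
  move=> ab; have := pe a; rewrite -(pe b); have := pl a b (ltnW ab); rewrite /shifted.
  have := ltn_ord b; move: (la ord0 a) (la ord0 b) => la_a la_b bm.
  by case: (a \in A); case: (b \in A); lia.
rewrite /alt_const !alt_sumE mulr_suml; apply: eq_bigr => s _.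
rewrite -!mulrA; congr (_ * _); rewrite mulrA.
rewrite [X in _ = _ * X](_ : _ = \prod_(r < size g) g`_r ^+ e); last first.
  by rewrite (big_nth 0) big_mkord prodrXl.
rewrite -mulrA -big_split /=; congr (_ * _); last first.
  apply: eq_bigr => r _; have g2 := gP (mem_nth 0 (ltn_ord r)).
  by rewrite -exprD (expr_parity _ g2) [RHS](expr_parity _ g2) odd_shift pe oddD oddb addbC.
apply: eq_bigr => i _; set a := s _; set b := s _.
have bda := bd a; have bdb := bd b.
apply: skew_eq => [||_].
- by move: bda bdb; rewrite /shifted; case: (a \in A); case: (b \in A); split; lia.
- by rewrite !odd_shift !pe; case: (e); case: (odd _); case: (odd _).
case: (ltngtP a b) => [ab|ba|/val_inj ->]; last by rewrite !ltnn.
  by have [-> ->] := lt _ _ ab.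
by have [h1 h2] := lt _ _ ba; rewrite !ltnNge (ltnW h1) (ltnW h2).
Qed.

(** Neighbouring parts of different parity have exponents of equal parity. Every exponent of the
    opposite parity compares in the same way with both, so exchanging the two preserves all
    pairings. *)
Lemma alt_sum_adjacent_parity la A (i j : 'I_m) : is_partition la ->
  (forall j, shifted la j + 1 < N)%N -> j = i.+1 :> nat ->
  odd (la ord0 i) (+) (i \in A) != odd (la ord0 j) (+) (j \in A) ->
  alt_sum (fun j => shifted la j + (j \in A))%N = 0.
Proof.
move/partitionP => pl bd ji pij; pose c k := (shifted la k + (k \in A))%N.
have ij : i != j by rewrite -val_eqE /= ji; lia.
have mono (a b : 'I_m) : (a < b)%N -> (c b <= c a)%N.
  move=> ab; have := pl a b (ltnW ab); rewrite /c /shifted.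
  have := ltn_ord b; move: (la ord0 a) (la ord0 b) => la_a la_b bm.
  by case: (a \in A); case: (b \in A); lia.
have par : odd (c i) = odd (c j).
  have oE : odd (m.-1 - i) = ~~ odd (m.-1 - j).
    by rewrite -oddS; congr odd; have := ltn_ord j; lia.
  rewrite !odd_shift oE; move: pij.
  by case: (odd _); case: (i \in A); case: (odd _); case: (j \in A); case: (odd _).
have bc k : (c k < N)%N.
  by apply: leq_ltn_trans (bd k); rewrite leq_add2l leq_b1.
(* Monotonicity puts [c k] weakly on one side of both exponents, and parity makes this strict. *)
have one (k : 'I_m) : k != i -> k != j -> odd (c i) != odd (c k) ->
    (c k < c i)%N = (c k < c j)%N /\ (c i < c k)%N = (c j < c k)%N.
  move=> ki kj oik; have nij := mono i j; rewrite ji ltnSn in nij.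
  have nik : c i <> c k by move=> e; rewrite e eqxx in oik.
  have njk : c j <> c k by move=> e; rewrite -e -par eqxx in oik.
  case: (ltngtP k i) => [kli|lik|/val_inj e]; last by rewrite e eqxx in ki.
    by have := mono k i kli; have := nij isT; move: nik njk; lia.
  have ljk : (j < k)%N.
    by rewrite ji ltn_neqAle lik andbT -ji; rewrite eq_sym -val_eqE in kj.
  by have := mono j k ljk; have := nij isT; move: nik njk; lia.
apply: (alt_sum_swap_eq0 gP ij) => [a b ab|a]; rewrite -/(c _); last first.
  by case: tpermP => [->|->|//]; rewrite par.
rewrite -/(c a) -/(c b) -/(c (tperm i j b)).
have E k : odd (c (tperm i j k)) = odd (c k) by case: tpermP => [->|->|//]; rewrite par.
apply: skew_eq => [||]; rewrite ?E // => oab.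
case: (tpermP i j a) oab ab => [->|->|/eqP ai /eqP aj];
  case: (tpermP i j b) => [->|->|/eqP bi /eqP bj]; rewrite ?par ?eqxx //.
- by move=> o _; rewrite -(one b bi bj _).1 // par.
- by move=> o _; rewrite (one b bi bj _).1 // par.
- by move=> o _; rewrite -(one a ai aj _).2 // par eq_sym.
- by move=> o _; rewrite (one a ai aj _).2 // par eq_sym.
Qed.

(** The sum survives only if adding [A] makes all parts even or all parts odd; otherwise some two
    neighbouring parts differ in parity. *)
Lemma alt_sum_cases la A : is_partition la -> (forall j, shifted la j + 1 < N)%N ->
  alt_sum (fun j => shifted la j + (j \in A))%N =
  alt_const * ((A == odd_set la)%:R + (\prod_(a <- g) a) * (A == ~: odd_set la)%:R).
Proof.
move=> pl bd; pose p (j : 'I_m) := odd (la ord0 j) (+) (j \in A).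
have [/forallP con|] := boolP [forall i, forall j, p i == p j]; last first.
  move=> ncon; have -> : (A == odd_set la) = false.
    apply: contraNF ncon => /eqP AE; apply/forallP => i; apply/forallP => j.
    by rewrite /p AE !inE !addbb.
  have -> : (A == ~: odd_set la) = false.
    apply: contraNF ncon => /eqP AE; apply/forallP => i; apply/forallP => j.
    by rewrite /p AE !inE !addbN !addbb.
  rewrite mulr0 addr0 mulr0.
  have [/forallP adj|] := boolP [forall i : 'I_m, forall j : 'I_m, (j == i.+1 :> nat) ==> (p i == p j)].
    case/negP: ncon; apply/forallP => i; apply/forallP => j; apply/eqP.
    apply: adjacent_constant => a b ba; apply/eqP.
    by have /forallP/(_ b)/implyP := adj a; apply; apply/eqP.
  move=> /forallPn[i /forallPn[j]]; rewrite negb_imply => /andP[/eqP ji pij].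
  exact: alt_sum_adjacent_parity pij.
pose e := p (Ordinal m_gt0).
have pe j : p j = e by have /forallP/(_ (Ordinal m_gt0))/eqP := con j.
rewrite (@alt_sum_const_parity la A e) //; congr (_ * _).
have AE1 : (A == odd_set la) = ~~ e.
  apply/eqP/idP => [AE|ne]; first by rewrite /e /p AE inE addbb.
  apply/setP => j; have := pe j; rewrite /p inE (negPf ne).
  by case: (j \in A); case: odd.
have AE2 : (A == ~: odd_set la) = e.
  apply/eqP/idP => [AE|ne]; first by rewrite /e /p AE !inE addbN addbb.
  apply/setP => j; have := pe j; rewrite /p !inE ne.
  by case: (j \in A); case: odd.
by rewrite AE1 AE2; case: (e); rewrite ?mulr0 ?mulr1 ?addr0 ?add0r ?expr1 ?expr0.
Qed.

(** Scaling the rows by [1 + t * ev_i] makes each column a sum of two; [A] collects the columns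
    whose exponent is raised. *)
Lemma alternant_add la (t : K) (x : {ffun 'I_v -> 'I_N}) :
  (\prod_(i < m) (1 + t * (evs g (pts z x))`_i)) * alternant (shifted la) x =
  \sum_(A : {set 'I_m}) t ^+ #|A| * alternant (fun j => shifted la j + (j \in A))%N x.
Proof.
rewrite /alternant -det_row_scale; set ev := evs g _.
rewrite (_ : \matrix_(i, j) _ = \matrix_(i, j) (ev`_i ^+ shifted la j) +
                               \matrix_(i, j) (t * ev`_i ^+ (shifted la j).+1)); last first.
  by apply/matrixP => i j; rewrite !mxE mulrDl mul1r -mulrA -exprS.
rewrite det_cols_add; apply: eq_bigr => A _.
rewrite -[X in _ = _ * X]det_tr.
have -> : t ^+ #|A| = \prod_(j < m) t ^+ (j \in A).
  by rewrite prodrXr -sum1_card big_mkcond.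
rewrite -det_row_scale -det_tr; congr (\det _); apply/matrixP => i j; rewrite !mxE.
by case: (i \in A); rewrite ?addn1 ?addn0 ?mul1r.
Qed.

Lemma alternant_mul_sum la (x : {ffun 'I_v -> 'I_N}) :
  (\sum_(i < m) (evs g (pts z x))`_i) * alternant (shifted la) x =
  \sum_j alternant (shifted (add_cell la j)) x.
Proof.
rewrite det_scale_col_sum; apply: eq_bigr => j _; congr (\det _); apply/matrixP => i k.
rewrite !mxE shifted_add_cell; case: eqP => [->|_]; last by rewrite addn0.
by rewrite addn1 exprS.
Qed.

(** The [n] factors add cells one at a time; then [t] records the odd parts, as the surviving [A]
    has [k] or [m - k] elements. The [n] in the bound leaves room for the exponents to grow. *)
Lemma alternant_sum_add_count n la (t : K) : is_partition la ->
  (forall j, shifted la j + n + 1 < N)%N ->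
  \sum_(x : {ffun 'I_v -> 'I_N}) (\sum_(i < m) (evs g (pts z x))`_i) ^+ n *
    ((\prod_(i < m) (1 + t * (evs g (pts z x))`_i)) * alternant (shifted la) x) / disc x =
  alt_const * \sum_(k < m.+1) (add_count n la k)%:R *
                (t ^+ k + (\prod_(a <- g) a) * t ^+ (m - k)).
Proof.
elim: n la => [|n IHn] la pl bd.
  under [LHS]eq_bigr => x _ do rewrite expr0 mul1r alternant_add mulr_suml.
  rewrite exchange_big /=.
  under [LHS]eq_bigr => A _.
    under eq_bigr => x _ do rewrite -mulrA.
    rewrite -mulr_sumr -/(alt_sum _) alt_sum_cases //; last by move=> j; rewrite -(addn0 (shifted _ _)).
    rewrite mulrCA.
  over.
  rewrite -mulr_sumr; congr (_ * _).
  have om : (#|odd_set la| < m.+1)%N by rewrite ltnS -[X in (_ <= X)%N]card_ord max_card.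
  rewrite [RHS](bigD1 (Ordinal om)) //= eqxx mul1r [X in _ + X]big1 ?addr0; last first.
    by move=> k ko; rewrite eq_sym (_ : (_ == _) = false) ?mul0r //; apply: contraNF ko.
  have oC : odd_set la != ~: odd_set la.
    apply/eqP => /setP /(_ (Ordinal m_gt0)); rewrite in_setC.
    by case: (_ \in _).
  rewrite (bigD1 (odd_set la)) //= eqxx (negPf oC) mulr0 addr0 mulr1; congr (_ + _).
  rewrite (bigD1 (~: odd_set la)) 1?eq_sym //= eqxx (negPf oC) add0r mulr1.
  rewrite [X in _ + X]big1 ?addr0; last first.
    by move=> A /andP[/negPf-> /negPf->]; rewrite mulr0 addr0 mulr0.
  by rewrite mulrC cardsCs setCK card_ord.
under [LHS]eq_bigr => x _.
  rewrite exprSr -[_ * _ * (_ * _)]mulrA [(\sum_i _) * (_ * _)]mulrCA alternant_mul_sum.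
  rewrite !mulr_sumr mulr_suml.
over.
rewrite exchange_big /= (bigID (fun j => is_partition (add_cell la j))) /=.
rewrite [X in _ + X]big1 ?addr0; last first.
  move=> j /(add_cell_not_partition pl)[i [ij lij]]; apply: big1 => x _.
  rewrite (@alternant_eq0 _ _ _ _ _ _ _ i j) ?mulr0 ?mul0r //.
    by rewrite -val_eqE /= -ij; lia.
  rewrite !shifted_add_cell /shifted lij eqxx -val_eqE /=.
  by have := ltn_ord j; rewrite -ij; case: eqP => //; lia.
under [LHS]eq_bigr => j pj.
  rewrite IHn //; last first.
    by move=> i; have := bd i; rewrite shifted_add_cell; case: (i == j); lia.
over.
rewrite -mulr_sumr exchange_big; congr (_ * _); apply: eq_bigr => k _.
by rewrite -mulr_suml natr_sum.
Qed.

End AdditionCount.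

(** * Weighted walks and orthogonal polynomials *)

(* The factor [q] is the weight of a step from [1] to [0] in the last coordinate,
   which is the only coordinate whose shifted value can go from [1] to [0]. *)
Definition wgt (q c : nat) : nat := if c is c'.+1 then (if c' == 0%N then q else 1%N) else 0%N.

Fixpoint walk_count q n v (mu : 'rV[nat]_v) : nat :=
  if n is n'.+1 then
    (\sum_(j | is_partition (add_cell mu j)) walk_count q n' (add_cell mu j) +
     \sum_(j | (0 < mu ord0 j) && is_partition (del_cell mu j))
        wgt q (shifted mu j) * walk_count q n' (del_cell mu j))%N
  else (mu == ones v 0).

Lemma ones0E v (j : 'I_v) : ones v 0 ord0 j = 0%N.
Proof. by rewrite mxE. Qed.

Lemma shifted_ones0 v (j : 'I_v) : shifted (ones v 0) j = (v.-1 - j)%N.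
Proof. by rewrite /shifted ones0E. Qed.

Lemma ones_partition v k : is_partition (ones v k).
Proof. by apply/partitionP => i j ij; rewrite !mxE; do 2 case: ifP => //; lia. Qed.

Section OrthogonalPolynomials.
Variables (K : numFieldType) (q : nat).

(** In the variable [t + 1/t] these are rescaled Chebyshev polynomials: for [q = 2] of the first
    kind, [t^c + t^-c] with [1] at [c = 0]; for [q = 1] of the second kind,
    [(t^(c+1) - t^-(c+1)) / (t - 1/t)]. *)
Fixpoint ob (c : nat) : {poly K} :=
  match c with
  | 0 => 1
  | c'.+1 => if c' is c''.+1 then 'X * ob c' - (wgt q c')%:R *: ob c'' else 'X
  end.

(** Multiplication by the variable is a step up plus a weighted step down. At [c = 0] the default
    [0.-1 = 0] is silenced by [wgt q 0 = 0]. *)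
Lemma ob_rec c : 'X * ob c = ob c.+1 + (wgt q c)%:R *: ob c.-1.
Proof. by case: c => [|c] /=; rewrite ?mulr1 ?scale0r ?addr0 // subrK. Qed.

Lemma ob_monic_size c : (ob c \is monic) * (size (ob c) = c.+1).
Proof.
elim/ltn_ind: c => -[|[|c]] IH; first by rewrite /= monic1 size_poly1.
  by rewrite /= monicX size_polyX.
have [m1 s1] := IH c.+1 (ltnSn _); have [m0 s0] := IH c (ltnW (ltnSn _)).
have sX : size ('X * ob c.+1) = c.+3.
  by rewrite mulrC size_mulX ?s1 // -size_poly_gt0 s1.
have lt : (size (- ((wgt q c.+1)%:R *: ob c))%R < size ('X * ob c.+1)%R)%N.
  by rewrite sX size_polyN (leq_ltn_trans (size_scale_leq _ _)) // s0; lia.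
rewrite -[ob c.+2]/('X * ob c.+1 - (wgt q c.+1)%:R *: ob c).
split; last by rewrite size_polyDl.
by rewrite monicE lead_coefDl // lead_coefM lead_coefX mul1r -monicE.
Qed.

Lemma ob_opp c y : (ob c).[- y] = (-1) ^+ c * (ob c).[y].
Proof.
elim/ltn_ind: c => -[|[|c]] IH; first by rewrite /= !hornerE.
  by rewrite /= !hornerE; ring.
rewrite -[ob c.+2]/('X * ob c.+1 - (wgt q c.+1)%:R *: ob c).
rewrite !(hornerE, hornerZ) (IH c.+1 (ltnSn _)) (IH c (ltnW (ltnSn _))).
by rewrite !exprS; ring.
Qed.

End OrthogonalPolynomials.

(** * Alternants of orthogonal polynomials as generators of walks *)

Section WalkSum.
Variables (K : numFieldType) (N : nat) (z : K).
Variables (v : nat) (g : seq K) (q : nat).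
Local Notation ob := (ob K q).
Implicit Types (mu : 'rV[nat]_v) (x : {ffun 'I_v -> 'I_N}).

Definition yv (x : 'I_N) : K := rt z x + (rt z x)^-1.
(** Each factor is [(X - a) (1/X - a)] at [y = X + 1/X]. For the points [1, -1] the product is
    [- (X - 1/X)^2]. *)
Definition om (y : K) : K := \prod_(a <- g) (1 + a ^+ 2 - a * y).
Definition gram c d : K := \sum_(x < N) (ob c).[yv x] * (ob d).[yv x] * om (yv x).
Hypothesis gram0 : forall c d, (c + d + 2 < N)%N -> c != d -> gram c d = 0.
Hypothesis gram1 : forall c, (c + c + 2 < N)%N -> gram c c != 0.

Definition walt (c : 'I_v -> nat) x : K :=
  \det (\matrix_(i < v, j < v) (ob (c j)).[yv (x i)]).
Definition omx x : K := \prod_i om (yv (x i)).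
Definition walk_const : K :=
  v`!%:R * \prod_(i < v) gram (v.-1 - i)%N (v.-1 - i)%N.

Lemma eq_walt c c' x : c =1 c' -> walt c x = walt c' x.
Proof. by move=> cc; congr (\det _); apply/matrixP => i j; rewrite !mxE cc. Qed.

Lemma walt_eq0 c x (i j : 'I_v) : i != j -> c i = c j -> walt c x = 0.
Proof. by move=> ij cij; apply: (det_eq_col ij) => k; rewrite !mxE cij. Qed.

(** A discrete Andreief identity: both determinants are expanded, and the sum over [x] factors by
    coordinates. *)
Lemma walt_gram c d : \sum_x walt c x * walt d x * omx x =
  \sum_(s : 'S_v) \sum_(s' : 'S_v)
     (-1) ^+ s * (-1) ^+ s' * \prod_i gram (c (s i)) (d (s' i)).
Proof.
transitivity (\sum_(s : 'S_v) \sum_(s' : 'S_v) \sum_(x : {ffun 'I_v -> 'I_N})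
  (-1) ^+ s * (-1) ^+ s' *
    \prod_i ((ob (c (s i))).[yv (x i)] * (ob (d (s' i))).[yv (x i)] * om (yv (x i)))).
  rewrite [RHS](eq_bigr _ (fun s _ => exchange_big _ _ _ _ _ _)) [RHS]exchange_big /=.
  apply: eq_bigr => x _.
  have E (c' : 'I_v -> nat) (s : 'S_v) :
      \prod_i (\matrix_(i < v, j < v) (ob (c' j)).[yv (x i)]) i (s i) =
      \prod_i (ob (c' (s i))).[yv (x i)].
    by apply: eq_bigr => i _; rewrite mxE.
  rewrite mulr_suml mulr_suml; apply: eq_bigr => s _.
  rewrite mulr_sumr mulr_suml; apply: eq_bigr => s' _; rewrite !big_split /= /omx.
  by rewrite !E mulrACA !mulrA.
apply: eq_bigr => s _; apply: eq_bigr => s' _; rewrite -mulr_sumr; congr (_ * _).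
by rewrite [RHS]bigA_distr_bigA.
Qed.

(** If [mu] is nonzero, its first shifted part is at least [v], above all degrees of the staircase,
    so every term has a zero Gram factor. For [mu = 0] only equal permutations remain, [v!] of
    them. *)
Lemma walt_orth mu : is_partition mu -> (forall j, shifted mu j + v + 2 < N)%N ->
  (v + v + 2 < N)%N ->
  \sum_x walt (shifted mu) x * walt (shifted (ones v 0)) x * omx x =
  walk_const * (mu == ones v 0)%:R.
Proof.
move=> /partitionP pm bd vN; rewrite walt_gram; case: (altP (mu =P _)) => [->|].
  rewrite mulr1 /walk_const mulr_natl -[X in _ *+ X]card_Sn -sumr_const.
  apply: eq_bigr => s _; rewrite (bigD1 s) //= -expr2 sqrr_sign mul1r.
  rewrite [X in _ + X]big1 ?addr0.
    rewrite [RHS](reindex_inj (@perm_inj _ s)) /=.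
    by apply: eq_bigr => i _; rewrite shifted_ones0.
  move=> s' ss'; have [i si] : exists i, s' i != s i.
    apply/existsP; apply: contraR ss' => /existsPn H; apply/eqP/permP => i.
    by have := H i; rewrite negbK => /eqP.
  rewrite (bigD1 i) //= gram0 ?mul0r ?mulr0 // !shifted_ones0; first by lia.
  by apply: contra si => /eqP e; apply/eqP/val_inj; have := ltn_ord (s i);
     have := ltn_ord (s' i); rewrite /=; lia.
move=> nz; have [j muj] : exists j, (0 < mu ord0 j)%N.
  apply/existsP; apply: contraR nz => /existsPn H; apply/eqP/rowP => j.
  by rewrite ones0E; have := H j; rewrite lt0n negbK => /eqP.
have v0 : (0 < v)%N by apply: leq_ltn_trans (ltn_ord j).
pose i0 := Ordinal v0; have mu0 : (v <= shifted mu i0)%N.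
  by have := pm i0 j (leq0n _); rewrite /shifted /=; lia.
rewrite mulr0; apply: big1 => s _; apply: big1 => s' _.
pose i := (s^-1 i0)%g; rewrite (bigD1 i) //= permKV gram0 ?mul0r ?mulr0 //.
  by have := bd i0; rewrite shifted_ones0; lia.
by rewrite shifted_ones0; have := ltn_ord (s' i); lia.
Qed.

Lemma walk_const_neq0 : (v + v + 2 < N)%N -> walk_const != 0.
Proof.
move=> vN; rewrite mulf_neq0 ?Num.Theory.pnatr_eq0 -?lt0n ?fact_gt0 //.
by apply/prodf_neq0 => i _; apply: gram1; lia.
Qed.

(** The three-term recurrence is applied to one column at a time. Terms that leave the partitions
    have two equal columns or weight zero. *)
Lemma walt_mul_sum mu x : is_partition mu ->
  (\sum_i yv (x i)) * walt (shifted mu) x =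
  \sum_(j | is_partition (add_cell mu j)) walt (shifted (add_cell mu j)) x +
  \sum_(j | (0 < mu ord0 j)%N && is_partition (del_cell mu j))
     (wgt q (shifted mu j))%:R * walt (shifted (del_cell mu j)) x.
Proof.
move=> pm; rewrite det_scale_col_sum.
pose M : 'M[K]_v := \matrix_(i, j) (ob (shifted mu j)).[yv (x i)].
have step (j : 'I_v) :
    \det (\matrix_(i, k) (if k == j then yv (x i) * M i k else M i k)) =
    walt (shifted (add_cell mu j)) x + (wgt q (shifted mu j))%:R *
      walt (fun k => shifted mu k - (k == j))%N x.
  transitivity (\det (\matrix_(i, k) (if k == j then (ob (shifted mu j).+1).[yv (x i)]
      + (wgt q (shifted mu j))%:R * (ob (shifted mu j).-1).[yv (x i)] else M i k))).
    congr (\det _); apply/matrixP => i k; rewrite !mxE; case: eqP => // ->.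
    have /(congr1 (fun p => p.[yv (x i)])) := ob_rec K q (shifted mu j).
    by rewrite hornerM hornerX hornerD hornerZ => ->.
  rewrite (det_col_linear M); congr (_ + _ * _); congr (\det _); apply/matrixP => i k; rewrite !mxE.
    by rewrite shifted_add_cell; case: eqP => [->|_]; rewrite ?addn1 ?addn0.
  by case: eqP => [->|_]; rewrite ?subn1 ?subn0.
rewrite (eq_bigr _ (fun j _ => step j)) big_split /=; congr (_ + _).
  rewrite (bigID (fun j => is_partition (add_cell mu j))) /= [X in _ + X]big1 ?addr0 //.
  move=> j /(add_cell_not_partition pm)[i [ij lij]].
  apply: (@walt_eq0 _ _ i j); first by rewrite -val_eqE /= -ij; lia.
  rewrite !shifted_add_cell /shifted lij eqxx -val_eqE /=.
  by have := ltn_ord j; rewrite -ij; case: eqP => //; lia.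
rewrite (bigID (fun j => (0 < mu ord0 j)%N && is_partition (del_cell mu j))) /=.
rewrite [X in _ + X]big1 ?addr0.
  apply: eq_bigr => j /andP[mj _]; congr (_ * _); apply: eq_walt => k.
  by rewrite /shifted mxE; case: eqP => [->|_]; lia.
(* An empty part cannot be lowered: in the last coordinate the weight is [wgt q 0 = 0], elsewhere
   the lowered index equals that of the next column, whose part is zero too. *)
move=> j; case: (posnP (mu ord0 j)) => [mj _|mj /=].
  case: (leqP v j.+1) => jv.
    by rewrite /shifted mj (_ : (v.-1 - j = 0)%N) ?mul0r //; lia.
  rewrite (@walt_eq0 _ _ (Ordinal jv) j) ?mulr0 //; first by rewrite -val_eqE /=; lia.
  have mj1 : mu ord0 (Ordinal jv) = 0%N.
    by have /partitionP/(_ j (Ordinal jv) (leqnSn _)) := pm; rewrite mj leqn0 => /eqP.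
  by rewrite /shifted mj mj1 eqxx -val_eqE /=; case: eqP => [|_]; lia.
move=> /(del_cell_not_partition pm)[i [ij lij]].
rewrite (@walt_eq0 _ _ i j) ?mulr0 //; first by rewrite -val_eqE /= ij; lia.
rewrite /shifted lij eqxx -val_eqE /= ij; case: eqP => [|_]; first by lia.
by have := ltn_ord i; lia.
Qed.

Lemma walt_sum_walk_count n mu : is_partition mu ->
  (forall j, shifted mu j + n + v + 2 < N)%N -> (v + v + 2 < N)%N ->
  \sum_(x : {ffun 'I_v -> 'I_N}) (\sum_i yv (x i)) ^+ n * (walt (shifted mu) x *
     walt (shifted (ones v 0)) x * omx x) = walk_const * (walk_count q n mu)%:R.
Proof.
elim: n mu => [|n IHn] mu pm bd vN.
  under eq_bigr => x _ do rewrite expr0 mul1r.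
  by rewrite walt_orth // => j; have := bd j; rewrite addn0.
under eq_bigr => x _.
  rewrite exprSr -[_ * _ * (_ * _)]mulrA [(\sum_i _) * (_ * _)]mulrA.
  rewrite [(\sum_i _) * (_ * _)]mulrA walt_mul_sum //.
  rewrite !mulrDl mulrDr !mulr_suml !mulr_sumr.
over.
rewrite big_split /= natrD mulrDr !natr_sum !mulr_sumr; congr (_ + _).
  rewrite exchange_big /=; apply: eq_bigr => j pj; rewrite IHn // => i.
  by have := bd i; rewrite shifted_add_cell; case: (i == j); lia.
rewrite exchange_big /=; apply: eq_bigr => j /andP[mj pj].
rewrite natrM mulrCA -IHn //.
  by rewrite mulr_sumr; apply: eq_bigr => x _; ring.
by move=> i; have := bd i; rewrite /shifted mxE; case: (i == j); lia.
Qed.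

End WalkSum.

(** * Comparison of the two sums *)

Section VandermondeFactorization.
Variables (K : numFieldType) (g : seq K).
Local Notation y a := (a + a^-1).

(** This is [(-1)^(k(k-1)/2)], one sign for each pair of points. *)
Definition block_sign (k : nat) : K := \prod_(i < k) (-1) ^+ i.

(** A pair [a, b] contributes [(a - b)(1/a - 1/b)(a - 1/b)(b - 1/a) = - (y a - y b)^2], and each [a]
    with its own inverse gives [a - 1/a]. *)
Lemma vdm_inverse_pairs (s : seq K) : all (fun a => a != 0) s ->
  vdm (s ++ [seq a^-1 | a <- s]) =
  block_sign (size s) * (\prod_(a <- s) (a - a^-1)) * vdm [seq y a | a <- s] ^+ 2.
Proof.
rewrite vdm_cat; elim: s => [_|a s IHs /= /andP[a0 s0]].
  by rewrite /block_sign /= !big_nil big_ord0; ring.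
rewrite !big_cons /block_sign big_ord_recr /= -/(block_sign _) !big_map /=.
have -> : \prod_(b <- s) \prod_(c <- a^-1 :: [seq i^-1 | i <- s]) (b - c) =
    \prod_(b <- s) (b - a^-1) * \prod_(b <- s) \prod_(c <- [seq i^-1 | i <- s]) (b - c).
  by rewrite -big_split; apply: eq_bigr => b _; rewrite big_cons.
have E : (\prod_(b <- s) (a - b)) * (\prod_(b <- s) (a^-1 - b^-1)) *
    (\prod_(b <- s) (a - b^-1)) * (\prod_(b <- s) (b - a^-1)) =
    (-1) ^+ size s * (\prod_(b <- s) (y a - y b)) ^+ 2.
  elim: s s0 {IHs} => [_|b s IHs /= /andP[b0 /IHs{}IHs]]; first by rewrite !big_nil; ring.
  rewrite !big_cons exprS; set P := \prod_(b <- s) (y a - y b) in IHs *.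
  transitivity ((a - b) * (a^-1 - b^-1) * (a - b^-1) * (b - a^-1) * ((-1) ^+ size s * P ^+ 2)).
    by rewrite -IHs; ring.
  by field; rewrite a0 b0.
have IH := IHs s0; move: E IH.
set A1 := \prod_(b <- s) (a - b); set A2 := \prod_(b <- s) (a^-1 - b^-1).
set A3 := \prod_(b <- s) (a - b^-1); set A4 := \prod_(b <- s) (b - a^-1).
set B := \prod_(b <- s) (y a - y b); set C := \prod_(b <- s) (b - b^-1).
set D := \prod_(b <- s) \prod_(c <- _) _; set V1 := vdm s; set V2 := vdm _; set V3 := vdm _.
move=> E IH; transitivity ((a - a^-1) * (A1 * A2 * A3 * A4) * (V1 * V2 * D)); first by ring.
by rewrite E IH; ring.
Qed.

Lemma vdm_evs (s : seq K) : all (fun a => a != 0) s ->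
  vdm (evs g s) = block_sign (size s) * vdm g * (\prod_(a <- s) (a - a^-1)) *
    (\prod_(a <- s) \prod_(b <- g) (1 + b ^+ 2 - b * y a)) * vdm [seq y a | a <- s] ^+ 2.
Proof.
move=> s0; rewrite /evs vdm_cat vdm_inverse_pairs // big_cat big_map /=.
rewrite -big_split /=.
rewrite (_ : \prod_(a <- s) (_ * _) =
   \prod_(a <- s) \prod_(b <- g) (1 + b ^+ 2 - b * y a)); first by ring.
apply: eq_big_seq => a /(allP s0) a0; rewrite -big_split; apply: eq_bigr => b _ /=.
by field.
Qed.

End VandermondeFactorization.

Section Comparison.
Variables (K : numFieldType) (N : nat) (z : K).
Hypotheses (zP : (2 * N).-primitive_root z) (evenN : ~~ odd N).
Variables (v : nat) (g : seq K) (q : nat).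
Hypothesis gP : forall a, a \in g -> a ^+ 2 = 1.
Hypothesis g0 : \sum_(a <- g) a = 0.
Hypothesis gU : vdm g != 0.
Local Notation m := (v + v + size g)%N.
Hypothesis m_gt0 : (0 < m)%N.
Hypothesis gram0 :
  forall c d, (c + d + 2 < N)%N -> c != d -> gram N z g q c d = 0.
Hypothesis gram1 : forall c, (c + c + 2 < N)%N -> gram N z g q c c != 0.
Local Notation ob := (ob K q).
Local Notation yv := (yv z).
Local Notation walt0 x := (walt z q (shifted (ones v 0)) x).
Implicit Types (x : {ffun 'I_v -> 'I_N}).

Definition ys x : seq K := [seq a + a^-1 | a <- pts z x].

Lemma size_ys x : size (ys x) = v.
Proof. by rewrite size_map size_pts. Qed.

Lemma size_evs_pts x : size (evs g (pts z x)) = m.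
Proof. by rewrite /evs !size_cat (size_map _ (pts z x)) !size_pts. Qed.

Lemma nth_ys x (i : 'I_v) : (ys x)`_i = yv (x i).
Proof. by rewrite (nth_map 0) ?size_pts // nth_pts. Qed.

Lemma walt0_vdm x : walt0 x = vdm (ys x).
Proof.
rewrite -(@det_monic_alternant _ v ob) => [|c|c|]; try by rewrite ob_monic_size.
  congr (\det _); apply/matrixP => i j.
  by rewrite !mxE nth_ys shifted_ones0.
by rewrite /= size_ys.
Qed.

Lemma big_pts (R : Type) (idx : R) (op : Monoid.com_law idx) (F : K -> R) x :
  \big[op/idx]_(a <- pts z x) F a = \big[op/idx]_(i < v) F (rt z (x i)).
Proof. by rewrite (big_map (fun i => rt z (x i))) big_enum. Qed.

(** The bridge between the two sides: up to a constant, the staircase alternant over [disc] is the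
    square of the walk alternant times the weight. *)
Lemma alternant0 x :
  @alternant K N z v g (shifted (ones m 0)) x =
  block_sign K v * vdm g * disc z x * (walt0 x * walt0 x * omx z g x).
Proof.
transitivity (vdm (evs g (pts z x))).
  rewrite -(@det_monic_alternant _ m (fun c => 'X^c)) => [|c|c|].
  - congr (\det _); apply/matrixP => i j.
    by rewrite !mxE hornerXn shifted_ones0.
  - exact: monicXn.
  - by rewrite size_polyXn.
  - exact: size_evs_pts.
rewrite vdm_evs; last by apply/allP => a /mapP[i _ ->]; exact: rt_neq0.
rewrite size_pts !big_pts -!walt0_vdm /disc /omx /om /yv.
by ring.
Qed.

(** Up to sign, the product extends the Vandermonde product of the [y_i] by the extra point [- t].
    The enlarged determinant is expanded along that row. *)
Lemma prod_add_walt (t : K) x :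
  (\prod_i (yv (x i) + t)) * walt0 x =
  \sum_(j < v.+1) (ob (v - j)).[t] * walt z q (shifted (ones v j)) x.
Proof.
have := @det_monic_alternant _ v.+1 ob (- t :: ys x) _ _ _.
rewrite /= -walt0_vdm (expand_det_row _ ord0) => /(_ _ _ _)/esym E.
apply: (mulfI (_ : (-1) ^+ v != 0)); first by rewrite signr_eq0.
transitivity ((\prod_(b <- ys x) (- t - b)) * walt0 x).
  rewrite mulrA; congr (_ * _); rewrite big_map big_pts -[X in (-1) ^+ X]card_ord -prodrN.
  by apply: eq_bigr => i _; rewrite opprD addrC.
rewrite E => [|c|c|]; try by rewrite ob_monic_size.
  rewrite mulr_sumr; apply: eq_bigr => j _; rewrite mxE /= ob_opp /cofactor /=.
  have -> : (-1) ^+ v = (-1) ^+ (v - j) * (-1) ^+ j :> K.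
    by rewrite -exprD subnK // -ltnS.
  rewrite add0n [X in _ * (_ * X) = _](_ : _ = walt z q (shifted (ones v j)) x); first by ring.
  congr (\det _); apply/matrixP => i k; rewrite !mxE /= nth_ys.
  (* Omitting column [j] from the staircase [v, ..., 0] leaves the first [j] indices one above the
     staircase of length [v], which is the partition [(1^j)]. *)
  congr ((ob _).[_]); rewrite /shifted /ones mxE /bump.
  by have kv := ltn_ord k; case: (ltnP k j) => kj /=; lia.
by rewrite /= size_ys.
Qed.

Lemma sum_evs x : \sum_(i < m) (evs g (pts z x))`_i = \sum_i yv (x i).
Proof.
transitivity (\sum_(a <- evs g (pts z x)) a).
  by rewrite [RHS](big_nth 0) big_mkord size_evs_pts.
by rewrite !big_cat /= g0 addr0 big_map !big_pts -big_split.
Qed.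

Lemma prod_evs_add (t : K) x :
  \prod_(i < m) (1 + t * (evs g (pts z x))`_i) =
  (\prod_(a <- g) (1 + t * a)) * \prod_i (1 + t * yv (x i) + t ^+ 2).
Proof.
transitivity (\prod_(a <- evs g (pts z x)) (1 + t * a)).
  by rewrite [RHS](big_nth 0) big_mkord size_evs_pts.
rewrite !big_cat /= big_map !big_pts -big_split mulrC; congr (_ * _).
apply: eq_bigr => i _ /=; have := rt_neq0 zP (x i); rewrite /yv => r0.
by field.
Qed.

(** One sum over roots of unity is evaluated twice and the common nonzero constant cancelled. The
    bound on [N] keeps all exponents below the wrap-around. *)
Lemma add_count_walk_count n (t : K) : t != 0 -> (n + m + v + 4 < N)%N ->
  \sum_(k < m.+1) (add_count n (ones m 0) k)%:R *
     (t ^+ k + (\prod_(a <- g) a) * t ^+ (m - k)) =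
  (\prod_(a <- g) (1 + t * a)) *
  \sum_(j < v.+1) t ^+ v * (ob (v - j)).[t + t^-1] * (walk_count q n (ones v j))%:R.
Proof.
move=> t0 nN; set W := walk_const N z v g q.
have vN : (v + v + 2 < N)%N by lia.
have W0 : W != 0 by exact: walk_const_neq0.
have kap0 : block_sign K v != 0 by apply/prodf_neq0 => i _; rewrite signr_eq0.
have d0 (x : {ffun 'I_v -> 'I_N}) : disc z x != 0 by apply/prodf_neq0 => i _; apply: rt_diff_neq0.
(* The two normalizing constants are matched at the empty partition. *)
have CE : alt_const N z v g = block_sign K v * vdm g * W.
  rewrite /alt_const /alt_sum; transitivity (block_sign K v * vdm g *
     \sum_(x : {ffun 'I_v -> 'I_N}) (walt0 x * walt0 x * omx z g x)).
    rewrite mulr_sumr; apply: eq_bigr => x _.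
    rewrite -(@eq_alternant _ _ _ _ _ (shifted (ones m 0))) ?alternant0; last first.
      by move=> j; rewrite shifted_ones0.
    by field; apply: d0.
  congr (_ * _); rewrite (walt_orth gram0) ?eqxx ?mulr1 //.
    exact: ones_partition.
  by move=> j; rewrite shifted_ones0; lia.
have C0 : alt_const N z v g != 0 by rewrite CE (mulf_neq0 (mulf_neq0 kap0 gU) W0).
apply: (mulfI C0); rewrite -alternant_sum_add_count //; first last.
- by move=> j; rewrite shifted_ones0; lia.
- exact: ones_partition.
transitivity (\sum_(j < v.+1) block_sign K v * vdm g * (\prod_(a <- g) (1 + t * a)) *
   (t ^+ v * (ob (v - j)).[t + t^-1]) *
   \sum_(x : {ffun 'I_v -> 'I_N}) (\sum_i yv (x i)) ^+ n *
     (walt z q (shifted (ones v j)) x * walt0 x * omx z g x)).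
  under [RHS]eq_bigr => j _ do rewrite mulr_sumr.
  rewrite exchange_big; apply: eq_bigr => x _ /=.
  rewrite sum_evs prod_evs_add alternant0.
  (* The factorization [1 + t y + t^2 = t (y + t + 1/t)] brings in [prod_add_walt] at [t + 1/t]. *)
  have -> : \prod_i (1 + t * yv (x i) + t ^+ 2) =
      t ^+ v * \prod_i (yv (x i) + (t + t^-1)).
    have -> : t ^+ v = \prod_(i < v) t by rewrite prodr_const card_ord.
    rewrite -big_split; apply: eq_bigr => i _ /=.
    by field.
  have P := prod_add_walt (t + t^-1) x.
  set S := (\sum_i _) ^+ n; set Y := \prod_i _ in P *; set G := \prod_(a <- g) _.
  transitivity (S * block_sign K v * vdm g * G * t ^+ v * walt0 x * omx z g x * (Y * walt0 x)).
    by field; apply: d0.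
  rewrite P mulr_sumr; apply: eq_bigr => j _; ring.
rewrite CE !mulr_sumr; apply: eq_bigr => j _.
rewrite (walt_sum_walk_count gram0) //.
- by rewrite -/W; ring.
- exact: ones_partition.
by move=> i; have := ltn_ord i; rewrite /shifted mxE; case: ifP; lia.
Qed.

End Comparison.

(** * The orthogonal and symplectic specializations *)

Section Specializations.
Variable K : numFieldType.
Implicit Types (t : K).

Lemma ob2E c t : t != 0 ->
  (ob K 2 c).[t + t^-1] = if c == 0%N then 1 else t ^+ c + t^-1 ^+ c.
Proof.
move=> t0; elim/ltn_ind: c => -[|[|c]] IH; first by rewrite /= hornerC.
  by rewrite /= hornerX !expr1.
rewrite -[ob K 2 c.+2]/('X * ob K 2 c.+1 - (wgt 2 c.+1)%:R *: ob K 2 c).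
rewrite !(hornerE, hornerZ) (IH c.+1 (ltnSn _)) (IH c (ltnW (ltnSn _))) /=.
case: c {IH} => [|c] /=; first by rewrite !exprS !expr0; field.
by rewrite !exprVn !exprS; field; rewrite t0 expf_neq0.
Qed.

Lemma ob1E c t : t != 0 ->
  (ob K 1 c).[t + t^-1] * (t - t^-1) = t ^+ c.+1 - t^-1 ^+ c.+1.
Proof.
move=> t0; elim/ltn_ind: c => -[|[|c]] IH; first by rewrite /= hornerC mul1r !expr1.
  by rewrite /= hornerX !exprS !expr0; field.
rewrite -[ob K 1 c.+2]/('X * ob K 1 c.+1 - (wgt 1 c.+1)%:R *: ob K 1 c).
rewrite !(hornerE, hornerZ) mulrBl -!mulrA (IH c.+1 (ltnSn _)) (IH c (ltnW (ltnSn _))) /=.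
rewrite (_ : (if _ then _ else _)%:R = 1); last by case: ifP.
by rewrite !exprVn !exprS; field; rewrite t0 expf_neq0.
Qed.

(** A nonzero difference would vanish at more integers [1, 2, ...] than its degree allows, and these
    are distinct in characteristic zero. Avoiding [t = 0] lets the evaluations use [t^-1]. *)
Lemma poly_eq_neq0 (p r : {poly K}) : (forall t, t != 0 -> p.[t] = r.[t]) -> p = r.
Proof.
move=> eq; apply/eqP; rewrite -subr_eq0; apply/negPn/negP => nz.
have := @max_poly_roots _ _ [seq i.+1%:R | i <- iota 0 (size (p - r))] nz.
rewrite size_map size_iota ltnn => H; apply: notF; apply: H.
  apply/allP => _ /mapP[i _ ->]; rewrite rootE hornerD hornerN eq ?subrr //.
  by rewrite Num.Theory.pnatr_eq0.
rewrite map_inj_uniq ?iota_uniq // => i j /eqP.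
by rewrite Num.Theory.eqr_nat eqSS => /eqP.
Qed.

Lemma sum_coef_Xn n k (F : nat -> K) : (k <= n)%N ->
  \sum_(i < n.+1) F i * ('X^i : {poly K})`_k = F k.
Proof.
rewrite -ltnS => kn; rewrite (bigD1 (Ordinal kn)) //= coefXn eqxx mulr1 big1 ?addr0 //.
move=> i ik; rewrite coefXn (_ : (k == i) = false) ?mulr0 //; apply: contraNF ik.
by move=> /eqP e; apply/eqP/val_inj; rewrite /= -e.
Qed.

Lemma sum_coef_Xn_rev n k (F : nat -> K) : (k <= n)%N ->
  \sum_(i < n.+1) F i * ('X^(n - i) : {poly K})`_k = F (n - k)%N.
Proof.
move=> kn; rewrite -(@sum_coef_Xn n (n - k) F) ?leq_subr //; apply: eq_bigr => i _.
rewrite !coefXn; congr (_ * _%:R); congr nat_of_bool.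
by have := ltn_ord i; rewrite ltnS => ile; apply/eqP/eqP; lia.
Qed.

Variables (N : nat) (z : K).
Hypotheses (zP : (2 * N).-primitive_root z) (evenN : ~~ odd N).

Lemma gram2E c d : (c + d + 2 < N)%N ->
  gram N z [::] 2 c d = if c == d then (if c == 0%N then N%:R else 2 * N%:R) else 0.
Proof.
move=> bd; rewrite /gram; under eq_bigr => x _.
  rewrite /om big_nil mulr1 /yv !ob2E ?(rt_neq0 zP) //.
over.
case: c bd => [|c] bd; case: d bd => [|d] bd /=.
- by rewrite sumr_const card_ord mulr1.
- transitivity (\sum_(x < N) (rt z x ^+ d.+1 * (rt z x)^-1 ^+ 0 + rt z x ^+ 0 * (rt z x)^-1 ^+ d.+1)).
    by apply: eq_bigr => x _; rewrite !expr0 ?mulr1 !mul1r ?mulr1.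
  by rewrite big_split /= !(sum_rt zP) ?addr0 //; lia.
- transitivity (\sum_(x < N) (rt z x ^+ c.+1 * (rt z x)^-1 ^+ 0 + rt z x ^+ 0 * (rt z x)^-1 ^+ c.+1)).
    by apply: eq_bigr => x _; rewrite !expr0 ?mulr1 !mul1r ?mulr1.
  by rewrite big_split /= !(sum_rt zP) ?addr0 //; lia.
transitivity (\sum_(x < N) (rt z x ^+ (c.+1 + d.+1) * (rt z x)^-1 ^+ 0 +
   rt z x ^+ c.+1 * (rt z x)^-1 ^+ d.+1 + rt z x ^+ d.+1 * (rt z x)^-1 ^+ c.+1 +
   rt z x ^+ 0 * (rt z x)^-1 ^+ (c.+1 + d.+1))).
  by apply: eq_bigr => x _; rewrite !exprD !expr0; ring.
rewrite !big_split /= !(sum_rt zP) ?addr0 //=; try lia.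
rewrite add0r (eq_sym d.+1) eqSS.
by case: eqP => _; rewrite ?addr0 //; ring.
Qed.

(** The weight is [- (X - 1/X)^2], which supplies the denominators of both second-kind
    polynomials. *)
Lemma gram1E c d : (c + d + 2 < N)%N ->
  gram N z [:: 1; -1] 1 c d = if c == d then 2 * N%:R else 0.
Proof.
move=> bd; rewrite /gram.
transitivity (\sum_(x < N) (- (rt z x ^+ (c.+1 + d.+1) * (rt z x)^-1 ^+ 0) +
   rt z x ^+ c.+1 * (rt z x)^-1 ^+ d.+1 + rt z x ^+ d.+1 * (rt z x)^-1 ^+ c.+1 -
   rt z x ^+ 0 * (rt z x)^-1 ^+ (c.+1 + d.+1))).
  apply: eq_bigr => x _; have r0 := rt_neq0 zP x; rewrite /om !big_cons big_nil /yv.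
  have e1 := ob1E c r0; have e2 := ob1E d r0.
  transitivity (- (((ob K 1 c).[rt z x + (rt z x)^-1] * (rt z x - (rt z x)^-1)) *
     ((ob K 1 d).[rt z x + (rt z x)^-1] * (rt z x - (rt z x)^-1)))).
    by field.
  by rewrite e1 e2 !exprD !expr0; ring.
rewrite !big_split /= !sumrN !(sum_rt zP) ?addr0 //=; try lia.
rewrite oppr0 add0r addr0 (eq_sym d.+1) eqSS.
by case: eqP => _; rewrite ?addr0 //; ring.
Qed.

End Specializations.

Lemma prim_root_even_large M : exists2 N, (M < N)%N &
  exists2 z : algC, (2 * N).-primitive_root z & ~~ odd N.
Proof.
exists (M.+1).*2; first by lia.
have pos : (0 < 2 * M.+1.*2)%N by lia.
by have [z zP] := C_prim_root_exists pos; exists z => //; rewrite odd_double.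
Qed.

(** * The orthogonal case: sums of complementary tableau counts *)

Section Orthogonal.
Variables (n w : nat).
Hypothesis w0 : (0 < w)%N.
Local Notation S k := (add_count n (ones (2 * w) 0) k).

(** With [g] empty and [q = 2], [t^w (t^(w-j) + t^-(w-j))] gives the two monomials on the right; at
    [j = w] the polynomial is [1] and a single monomial remains. *)
Lemma orthogonal_poly :
  \sum_(k < (2 * w).+1) (S k)%:R *: ('X^k + 'X^(2 * w - k)) =
  \sum_(j < w.+1) (walk_count 2 n (ones w j))%:R *:
     (if j == w :> nat then 'X^w else 'X^j + 'X^(2 * w - j)) :> {poly algC}.
Proof.
apply: poly_eq_neq0 => t t0.
have [N NB [z zP eN]] := prim_root_even_large (n + (w + w + 0) + w + 4).
have g2 (a : algC) : a \in ([::] : seq algC) -> a ^+ 2 = 1 by [].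
have g0 : \sum_(a <- [::]) a = 0 :> algC by rewrite big_nil.
have gU : vdm ([::] : seq algC) != 0 by exact: oner_neq0.
have m0 : (0 < w + w + size ([::] : seq algC))%N by lia.
have gr0 c d : (c + d + 2 < N)%N -> c != d -> gram N z [::] 2 c d = 0.
  by move=> bd cd; rewrite (gram2E zP) // (negPf cd).
have gr1 c : (c + c + 2 < N)%N -> gram N z [::] 2 c c != 0.
  move=> bd; have N0 : N%:R != 0 :> algC by rewrite Num.Theory.pnatr_eq0; lia.
  rewrite (gram2E zP) // eqxx; case: (c =P 0%N) => _ //.
  by apply: mulf_neq0 => //; rewrite Num.Theory.pnatr_eq0.
have := add_count_walk_count zP eN g2 g0 gU m0 gr0 gr1 t0 NB.
rewrite /= !big_nil (_ : (w + w + 0 = 2 * w)%N); last by lia.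
rewrite !horner_sum mul1r => H; transitivity (\sum_(k < (2 * w).+1) (S k)%:R *
    (t ^+ k + 1 * t ^+ (2 * w - k))).
  by apply: eq_bigr => k _; rewrite hornerZ hornerD !hornerXn mul1r.
rewrite H.
apply: eq_bigr => j _; rewrite hornerZ ob2E // mulrC; congr (_ * _).
have jw : (j <= w)%N by rewrite -ltnS.
rewrite subn_eq0 (_ : (w <= j)%N = (j == w :> nat)); last by lia.
case: eqP => _; first by rewrite mulr1 hornerXn.
rewrite hornerD !hornerXn mulrDr -exprD addrC -{1}(subnK jw) exprD exprVn.
rewrite mulrAC divff ?mul1r ?expf_neq0 //; congr (_ + _ ^+ _); lia.
Qed.

(** Coefficients up to [X^w] are compared: for [j < w] the mirror exponent [2 * w - j] lies above
    [w]. At [k = w] the left side is twice [S w]. *)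
Lemma orthogonal_coef k : (k <= w)%N ->
  (S k + S (2 * w - k))%N = walk_count 2 n (ones w k).
Proof.
move=> kw; have := congr1 (fun p : {poly algC} => p`_k) orthogonal_poly.
rewrite !coef_sum; under eq_bigr => i _ do rewrite coefZ coefD mulrDr.
have k2 : (k <= 2 * w)%N by lia.
rewrite big_split /= (sum_coef_Xn (fun k => (S k)%:R)) // (sum_coef_Xn_rev (fun k => (S k)%:R)) //.
rewrite -natrD => H; apply/eqP; rewrite -(Num.Theory.eqr_nat algC) H; apply/eqP.
pose F j : algC := (walk_count 2 n (ones w j))%:R.
transitivity (\sum_(j < w.+1) F j * ('X^j : {poly algC})`_k).
  apply: eq_bigr => j _; rewrite coefZ; congr (_ * _); have := ltn_ord j; rewrite ltnS => jw.
  case: eqP => [->//|nj]; rewrite coefD !coefXn (_ : (k == 2 * w - j)%N = false) ?addr0 //.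
  by apply/eqP; lia.
by rewrite sum_coef_Xn.
Qed.

End Orthogonal.

(** * The symplectic case: differences of complementary tableau counts *)

Section Symplectic.
Variables (n v : nat).
Local Notation S k := (add_count n (ones (2 * v.+1) 0) k).

(** Here [g] is [1, -1], with product [-1], and [q = 1]. The prefactor [1 - t^2 = - t (t - 1/t)]
    clears the denominator of the second-kind polynomials. *)
Lemma symplectic_poly :
  \sum_(k < (2 * v.+1).+1) (S k)%:R *: ('X^k - 'X^(2 * v.+1 - k)) =
  \sum_(j < v.+1) (walk_count 1 n (ones v j))%:R *: ('X^j - 'X^(2 * v.+1 - j)) :> {poly algC}.
Proof.
apply: poly_eq_neq0 => t t0.
have [N NB [z zP eN]] := prim_root_even_large (n + (v + v + 2) + v + 4).
have g2 (a : algC) : a \in [:: 1; -1] -> a ^+ 2 = 1.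
  by rewrite !inE => /orP[] /eqP->; rewrite ?sqrrN expr1n.
have g0 : \sum_(a <- [:: 1; -1]) a = 0 :> algC by rewrite !big_cons big_nil addr0 subrr.
have gU : vdm [:: 1; -1 : algC] != 0.
  by rewrite /= !big_cons !big_nil !mulr1 opprK -mulr2n Num.Theory.pnatr_eq0.
have m0 : (0 < v + v + size [:: 1; -1 : algC]%R)%N by rewrite addn2.
have gr0 c d : (c + d + 2 < N)%N -> c != d -> gram N z [:: 1; -1] 1 c d = 0.
  by move=> bd cd; rewrite (gram1E zP) // (negPf cd).
have gr1 c : (c + c + 2 < N)%N -> gram N z [:: 1; -1] 1 c c != 0.
  move=> bd; have N0 : N%:R != 0 :> algC by rewrite Num.Theory.pnatr_eq0; lia.
  by rewrite (gram1E zP) // eqxx; apply: mulf_neq0 => //; rewrite Num.Theory.pnatr_eq0.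
have := add_count_walk_count zP eN g2 g0 gU m0 gr0 gr1 t0 NB.
rewrite /= !big_cons !big_nil (_ : (v + v + 2 = 2 * v.+1)%N); last by lia.
rewrite !horner_sum => H; transitivity (\sum_(k < (2 * v.+1).+1) (S k)%:R *
    (t ^+ k + (1 * (-1 * 1)) * t ^+ (2 * v.+1 - k))).
  by apply: eq_bigr => k _; rewrite hornerZ hornerD hornerN !hornerXn mul1r mulr1 mulN1r.
rewrite H mulr_sumr; apply: eq_bigr => j _; rewrite hornerZ hornerD hornerN !hornerXn.
have jv : (j <= v)%N by rewrite -ltnS.
rewrite mulrA [RHS]mulrC; congr (_ * _).
transitivity (- (t ^+ v.+1 * ((ob algC 1 (v - j)).[t + t^-1] * (t - t^-1)))).
  by rewrite exprS; field.
rewrite ob1E // mulrBr -exprD opprB exprVn -subSn // (_ : (v.+1 + (v.+1 - j) = 2 * v.+1 - j)%N); last by lia.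
congr (_ - _); have jv' : (j <= v.+1)%N by lia.
by rewrite -{1}(subnKC jv') exprD mulfK // expf_neq0.
Qed.

Lemma symplectic_coef k : (k <= v)%N ->
  S k = (S (2 * v.+1 - k) + walk_count 1 n (ones v k))%N.
Proof.
move=> kv; have := congr1 (fun p : {poly algC} => p`_k) symplectic_poly.
rewrite !coef_sum; under eq_bigr => i _ do rewrite coefZ coefB mulrBr.
have k2 : (k <= 2 * v.+1)%N by lia.
rewrite sumrB (sum_coef_Xn (fun k => (S k)%:R)) // (sum_coef_Xn_rev (fun k => (S k)%:R)) //.
move/eqP; rewrite subr_eq addrC => /eqP H.
apply/eqP; rewrite -(Num.Theory.eqr_nat algC) natrD H; apply/eqP; congr (_ + _).
pose F j : algC := (walk_count 1 n (ones v j))%:R.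
transitivity (\sum_(j < v.+1) F j * ('X^j : {poly algC})`_k).
  apply: eq_bigr => j _; rewrite coefZ; congr (_ * _); have := ltn_ord j; rewrite ltnS => jv.
  rewrite coefB !coefXn (_ : (k == 2 * v.+1 - j)%N = false) ?subr0 //.
  by apply/eqP; lia.
by rewrite sum_coef_Xn.
Qed.

End Symplectic.

Local Close Scope ring_scope.

(** * Marked walks *)

(** The factor is 2 for a last-coordinate step off the wall, which may be marked or not. *)
Fixpoint star_count n w (mu : 'rV[nat]_w) : nat :=
  if n is n'.+1 then
    \sum_(j | is_partition (add_cell mu j))
        (1 + ((j.+1 == w) && (mu ord0 j == 0))) * star_count n' (add_cell mu j) +
    \sum_(j | (0 < mu ord0 j) && is_partition (del_cell mu j)) star_count n' (del_cell mu j)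
  else mu == ones w 0.

(** No mark is possible before the first [eps_w] step; that step is taken unmarked, and the rest is
    free as in [star_count]. *)
Fixpoint zero_count n w (mu : 'rV[nat]_w) : nat :=
  if n is n'.+1 then
    \sum_(j | is_partition (add_cell mu j))
        (if j.+1 == w then star_count n' (add_cell mu j)
         else zero_count n' (add_cell mu j)) +
    \sum_(j | (0 < mu ord0 j) && is_partition (del_cell mu j)) zero_count n' (del_cell mu j)
  else mu == ones w 0.

Definition wall_factor w (mu : 'rV[nat]_w) : nat :=
  if [exists i : 'I_w, (i.+1 == w) && (0 < mu ord0 i)] then 2 else 1.

Lemma wall_factorE w (mu : 'rV[nat]_w) (i : 'I_w) : i.+1 = w ->
  wall_factor mu = if 0 < mu ord0 i then 2 else 1.
Proof.
move=> iw; congr (if _ then _ else _); apply/existsP/idP => [[k /andP[/eqP kw]]|mi].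
  by rewrite (_ : k = i) //; apply: val_inj; move: kw; rewrite -[in RHS]iw => -[].
by exists i; rewrite iw eqxx.
Qed.

(* From the wall, a walk ending at [0] leaves and reaches the wall equally often, so the
   weight can be moved from the steps leaving [x_w = 0] to those reaching it. *)
Lemma walk_count_star n w (mu : 'rV[nat]_w) :
  walk_count 2 n mu = wall_factor mu * star_count n mu.
Proof.
elim: n mu => [|n IHn] mu /=.
  case: eqP => [->|_]; last by rewrite muln0.
  by rewrite /wall_factor muln1; case: existsP => // -[i]; rewrite mxE andbF.
have last_or (j : 'I_w) : exists2 i : 'I_w, i.+1 = w & (j.+1 == w) = (i == j).
  have w0 : w.-1 < w by have := ltn_ord j; lia.
  exists (Ordinal w0); rewrite /=; first by lia.
  by rewrite -val_eqE /=; lia.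
rewrite mulnDr !big_distrr /=; congr (_ + _).
  apply: eq_bigr => j _; rewrite IHn mulnA; congr (_ * _).
  have [i iw ->] := last_or j; rewrite !(wall_factorE _ iw) mxE.
  by case: eqP => [->|_]; rewrite ?addn0 ?muln1 ?addn1 //=; case: (mu ord0 j).
apply: eq_bigr => j /andP[mj _]; rewrite IHn mulnA; congr (_ * _).
have [i iw e] := last_or j; rewrite !(wall_factorE _ iw) mxE /shifted.
have jw := ltn_ord j; case: (i =P j) e => [->|_] /eqP e.
  rewrite (_ : w.-1 - j = 0); last by lia.
  by case: (mu ord0 j) mj => [|[|k]].
have [k ->] : exists k, mu ord0 j + (w.-1 - j) = k.+2.
  by exists (mu ord0 j + (w.-1 - j) - 2); lia.
by rewrite subn0 mul1n.
Qed.

(** * The first step off the wall *)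

Section FirstWallStep.
Variable v : nat.
Implicit Types nu : 'rV[nat]_v.

Definition extend nu : 'rV[nat]_v.+1 :=
  \row_i (if unlift ord_max i is Some j then nu ord0 j else 0).

Lemma extend_max nu : extend nu ord0 ord_max = 0.
Proof. by rewrite mxE unlift_none. Qed.

Lemma extend_widen nu (j : 'I_v) : extend nu ord0 (widen_ord (leqnSn v) j) = nu ord0 j.
Proof.
by rewrite mxE (_ : widen_ord _ _ = lift ord_max j) ?liftK //; apply/val_inj/esym/lift_max.
Qed.

Lemma ord_maxP (i : 'I_v.+1) : i = ord_max \/ exists j, i = widen_ord (leqnSn v) j.
Proof.
case: (unliftP ord_max i) => [j ->|->]; last by left.
by right; exists j; apply/val_inj/lift_max.
Qed.

Lemma widen_neq_max (j : 'I_v) : (ord_max == widen_ord (leqnSn v) j) = false.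
Proof. by rewrite -val_eqE /=; have := ltn_ord j; lia. Qed.

Lemma extend_add nu j :
  add_cell (extend nu) (widen_ord (leqnSn v) j) = extend (add_cell nu j).
Proof.
apply/rowP => i; have [->|[k ->]] := ord_maxP i.
  by rewrite mxE !extend_max widen_neq_max.
by rewrite mxE !extend_widen mxE.
Qed.

Lemma extend_del nu j :
  del_cell (extend nu) (widen_ord (leqnSn v) j) = extend (del_cell nu j).
Proof.
apply/rowP => i; have [->|[k ->]] := ord_maxP i.
  by rewrite mxE !extend_max.
by rewrite mxE !extend_widen mxE.
Qed.

Lemma extend_partition nu : is_partition (extend nu) = is_partition nu.
Proof.
apply/partitionP/partitionP => H a b ab.
  by have := H (widen_ord (leqnSn v) a) (widen_ord (leqnSn v) b) ab; rewrite !extend_widen.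
have [->|[d de]] := ord_maxP b; first by rewrite extend_max.
have [ae|[c ce]] := ord_maxP a; first by move: ab; rewrite ae de /=; have := ltn_ord d; lia.
by rewrite de ce !extend_widen; apply: H; move: ab; rewrite de ce.
Qed.

Lemma extend_ones k : k <= v -> extend (ones v k) = ones v.+1 k.
Proof.
move=> kv; apply/rowP => i; have [->|[j ->]] := ord_maxP i.
  by rewrite extend_max mxE /= ltnNge kv.
by rewrite extend_widen !mxE.
Qed.

Lemma extend_inj : injective extend.
Proof. by move=> a b ab; apply/rowP => j; rewrite -!extend_widen ab. Qed.

(** Until its first [eps_w] step a walk from [extend nu] stays on the wall, so that step may be
    marked or not, and half of these marked walks are counted by [zero_count]. Walks without such a
    step carry no marks and live in [v] coordinates; they account for the last term. *)
Lemma zero_count_double n nu :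
  2 * zero_count n (extend nu) = star_count n (extend nu) + walk_count 1 n nu.
Proof.
elim: n nu => [|n IHn] nu.
  by rewrite /= -(extend_ones (leq0n v)) (inj_eq extend_inj) mul2n addnn.
rewrite /= mulnDr addnACA; congr (_ + _).
  (* The last coordinate is split off: there the factor [1 + 1] matches the [2] on the left. *)
  rewrite !(big_mkcond (fun j => is_partition (add_cell (extend nu) j))) /=.
  rewrite !big_ord_recr /= extend_max !eqxx /= mulnDr.
  rewrite [RHS]addnAC; congr (_ + _); last first.
    by case: ifP => _; rewrite ?muln0.
  rewrite big_distrr [X in _ = _ + X]big_mkcond -big_split /=; apply: eq_bigr => j _.
  rewrite extend_add extend_partition; case: ifP => // _.
  rewrite (_ : (j.+1 == v.+1) = false) ?IHn ?addn0 ?mul1n //.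
  by have := ltn_ord j; lia.
rewrite !(big_mkcond (fun j => _ && is_partition (del_cell (extend nu) j))) /=.
rewrite !big_ord_recr /= extend_max /= !addn0.
rewrite big_distrr [X in _ = _ + X]big_mkcond -big_split /=; apply: eq_bigr => j _.
rewrite extend_widen extend_del extend_partition; case: ifP => // /andP[nj _].
rewrite IHn /shifted; case: (nu ord0 j) nj => //= a _.
by case: ifP; rewrite mul1n.
Qed.

End FirstWallStep.

Lemma card_tuple_cons (L : finType) n (p : pred (seq L)) :
  #|[set t : n.+1.-tuple L | p t]| = \sum_(l : L) #|[set t : n.-tuple L | p (l :: t)]|.
Proof.
rewrite -sum1_card; under [RHS]eq_bigr => l _ do rewrite -sum1_card.
rewrite pair_big_dep /=.
rewrite (reindex (fun lt : L * n.-tuple L => [tuple of lt.1 :: lt.2])) /=.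
  by apply: eq_bigl => -[l t]; rewrite !inE.
exists (fun t : n.+1.-tuple L => (thead t, [tuple of behead t])) => [[l t]|t] _.
  by congr pair; apply: val_inj.
by rewrite [RHS]tuple_eta; apply: val_inj.
Qed.

Lemma card_tuple0 (L : finType) (p : pred (seq L)) :
  #|[set t : 0.-tuple L | p t]| = p [::].
Proof.
have -> : [set t : 0.-tuple L | p t] = if p [::] then setT else set0.
  by apply/setP => t; rewrite inE tuple0; case: ifP; rewrite !inE.
by case: ifP => _; rewrite ?cards0 // cardsT card_tuple expn0.
Qed.

(** * Marked walks as words of letters *)

Section MarkedWords.
Variable w : nat.
Implicit Types (mu : 'rV[nat]_w).

(* A letter is a coordinate, the direction of the step (up if [true]) and its mark. *)
Definition letter : finType := ('I_w * bool * bool)%type.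
Implicit Types (l : letter) (s : seq letter).

Definition move mu l := if l.1.2 then add_cell mu l.1.1 else del_cell mu l.1.1.
Definition is_top l := l.1.2 && (l.1.1.+1 == w).
Definition legal mu l :=
  [&& is_partition (move mu l), l.1.2 || (0 < mu ord0 l.1.1)
    & l.2 ==> is_top l && (mu ord0 l.1.1 == 0)].

Fixpoint star_word mu s :=
  if s is l :: s' then legal mu l && star_word (move mu l) s' else mu == ones w 0.

Fixpoint zero_word mu s :=
  if s is l :: s' then
    legal mu l && (if is_top l then ~~ l.2 && star_word (move mu l) s'
                   else zero_word (move mu l) s')
  else mu == ones w 0.

Lemma sum_letter (F : letter -> nat) :
  \sum_l F l = \sum_j (F (j, true, true) + F (j, true, false)
                     + (F (j, false, true) + F (j, false, false))).
Proof.
rewrite (eq_bigr (fun p => F (p.1, p.2))); last by case.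
rewrite -(pair_bigA _ (fun a b => F (a, b))) /=.
rewrite (eq_bigr (fun p => F (p.1, p.2, true) + F (p.1, p.2, false))); last first.
  by case=> a b _; rewrite big_bool.
rewrite -(pair_bigA _ (fun a b => F (a, b, true) + F (a, b, false))) /=.
by apply: eq_bigr => j _; rewrite big_bool.
Qed.

Lemma card_false n (p : pred (n.-tuple letter)) : p =1 xpred0 -> #|[set t | p t]| = 0.
Proof. by move=> p0; apply: eq_card0 => t; rewrite inE p0. Qed.

Lemma star_countS n mu : star_count n.+1 mu =
  \sum_(j | is_partition (add_cell mu j))
      (1 + ((j.+1 == w) && (mu ord0 j == 0))) * star_count n (add_cell mu j) +
  \sum_(j | (0 < mu ord0 j) && is_partition (del_cell mu j)) star_count n (del_cell mu j).
Proof. by []. Qed.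

Lemma star_countE n mu : star_count n mu = #|[set t : n.-tuple letter | star_word mu t]|.
Proof.
elim: n mu => [|n IHn] mu; first by rewrite (card_tuple0 (star_word mu)).
have E l : #|[set t : n.-tuple letter | star_word mu (l :: t)]| =
    if legal mu l then star_count n (move mu l) else 0.
  by rewrite /=; case: (legal mu l); rewrite ?IHn // card_false.
rewrite (card_tuple_cons _ (star_word mu)) (eq_bigr _ (fun l _ => E l)) sum_letter.
rewrite star_countS [RHS]big_split [X in X + _ = _]big_mkcond [X in _ + X = _]big_mkcond.
congr (_ + _); apply: eq_bigr => j _; rewrite /legal /is_top /move.
  cbn [fst snd andb orb implb]; rewrite !andbT.
  case: (is_partition _) => //; rewrite mulnDl mul1n addnC; congr (_ + _).
  by case: (_ && _); rewrite ?mul1n ?mul0n.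
by cbn [fst snd andb orb implb]; rewrite !andbF !andbT add0n andbC.
Qed.

Lemma zero_countE n mu : zero_count n mu = #|[set t : n.-tuple letter | zero_word mu t]|.
Proof.
elim: n mu => [|n IHn] mu; first by rewrite (card_tuple0 (zero_word mu)).
have E l : #|[set t : n.-tuple letter | zero_word mu (l :: t)]| =
    if legal mu l then if is_top l then if l.2 then 0 else star_count n (move mu l)
      else zero_count n (move mu l) else 0.
  rewrite /=; case: (legal mu l); last by rewrite card_false.
  case: (is_top l) => /=; last by rewrite IHn.
  by case: l.2 => /=; rewrite ?star_countE // card_false.
rewrite (card_tuple_cons _ (zero_word mu)) (eq_bigr _ (fun l _ => E l)) sum_letter /=.
rewrite [RHS]big_split [X in X + _ = _]big_mkcond [X in _ + X = _]big_mkcond.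
congr (_ + _); apply: eq_bigr => j _; rewrite /legal /is_top /move /=.
  rewrite andbT; case: (is_partition _) => //=.
  by case: (_.+1 == w) => //=; case: (_ == 0).
by rewrite !andbF !andbT add0n andbC.
Qed.

Lemma star_wordP (l0 : letter) mu s :
  reflect ((forall i, i < size s -> legal (foldl move mu (take i s)) (nth l0 s i))
           /\ foldl move mu s = ones w 0) (star_word mu s).
Proof.
elim: s mu => [|l s IHs] mu /=.
  by apply: (iffP eqP) => [|[]].
apply: (iffP andP) => [[ll /IHs[ls e]]|[ls e]].
  by split=> // -[|i] //= /ls.
split; first exact: (ls 0).
by apply/IHs; split=> // i si; apply: (ls i.+1).
Qed.

Lemma star_word_end mu s : star_word mu s -> foldl move mu s = ones w 0.
Proof. by elim: s mu => [mu /eqP|l s IHs mu /= /andP[_ /IHs]]. Qed.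

Lemma zero_word_star mu s : zero_word mu s -> star_word mu s.
Proof.
elim: s mu => //= l s IHs mu /andP[->]; case: ifP => [_ /andP[_ ->] //|_ /IHs ->] //.
Qed.

Lemma zero_wordP (l0 : letter) mu s :
  reflect (star_word mu s /\
    forall i, i < size s -> is_top (nth l0 s i) ->
      (forall k, k < i -> ~~ is_top (nth l0 s k)) -> ~~ (nth l0 s i).2)
   (zero_word mu s).
Proof.
elim: s mu => [|l s IHs] mu /=.
  by apply: (iffP idP) => [->|[]].
apply: (iffP andP) => [[ll]|[/andP[ll ls] H]].
  case: ifP => [lt /andP[lm ls]|lt /IHs[ls H]]; rewrite ll.
    by split=> // -[|i] //= _ _ /(_ 0 isT); rewrite /= lt.
  split=> // -[|i] /=; first by rewrite lt.
  by move=> si ti ki; apply: H => // k kk; apply: (ki k.+1).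
split=> //; case: ifP => lt.
  by rewrite ls andbT; apply: (H 0).
apply/IHs; split=> // i si ti ki; apply: (H i.+1) => // -[|k] //=; first by rewrite lt.
by apply: ki.
Qed.

(** Legality asks for a nonempty row in a deletion, so truncated subtraction never hides a step. *)
Lemma move_eq mu l l' : legal mu l -> legal mu l' -> l.2 = l'.2 ->
  move mu l = move mu l' -> l = l'.
Proof.
case: l l' => [[j u] b] [[j' u'] b'] /and3P[_ /= h _] /and3P[_ /= h' _] ->.
rewrite /move /= => /rowP e; have ej := e j; have {e}ej' := e j'; move: ej ej' h h'.
case: u; case: u' => /=; rewrite !mxE !eqxx ?(eq_sym j' j); case: eqP => [->//|_] /=; lia.
Qed.

End MarkedWords.

(** * Bijection between words and marked vacillating tableaux *)

Section WalkWords.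
Variables (n w : nat) (mu : 'rV[nat]_w).
Hypothesis mu_part : is_partition mu.
Local Notation letter := (letter w).
Implicit Types (T : 'I_n.+1 -> 'rV[nat]_w) (t : n.-tuple letter) (S : {set 'I_n}).

Lemma tuple_nil (n0 : n = 0) t : tval t = [::].
Proof. by apply: size0nil; rewrite size_tuple. Qed.

Definition follows T t :=
  T ord0 = mu /\ forall j, T (step_tgt j) = move (T (step_src j)) (tnth t j).

Lemma followsE T t i : follows T t -> T i = foldl (@move w) mu (take i t).
Proof.
case=> T0 Tj; case: i => i; elim: i => [|i IHi] i1.
  by rewrite take0 /= -T0; congr T; apply: val_inj.
have i0 : i < n by [].
rewrite (_ : Ordinal i1 = step_tgt (Ordinal i0)); last exact: val_inj.
rewrite Tj (_ : step_src _ = Ordinal (ltnW i1)); last exact: val_inj.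
pose l0 := tnth t (Ordinal i0).
by rewrite IHi /= (take_nth l0) ?size_tuple // -cats1 foldl_cat (tnth_nth l0).
Qed.

Lemma follows_legal T t j : follows T t -> star_word mu t ->
  legal (T (step_src j)) (tnth t j).
Proof.
move=> fT /(star_wordP (tnth t j))[/(_ j) H _].
by rewrite (followsE _ fT) (tnth_nth (tnth t j)); apply: H; rewrite size_tuple.
Qed.

Lemma step_move T t j : follows T t -> star_word mu t ->
  step T j = (if (tnth t j).1.2 then eps (tnth t j).1.1 else - eps (tnth t j).1.1)%R.
Proof.
move=> fT st; have := follows_legal j fT st; rewrite /step fT.2 /legal /move.
case: (tnth t j) => [[i u] b] /= /and3P[_ h _]; apply/rowP => k; rewrite !mxE.
case: u h => /= h; rewrite !mxE ?eqxx /=; case: eqP h => [->|_] h.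
- by rewrite PoszD addrAC subrr add0r.
- by rewrite addn0 subrr.
- by rewrite -subzn // addrAC subrr add0r.
by rewrite subn0 subrr oppr0.
Qed.

Lemma eps_inj (i i' : 'I_w) : (eps i == eps i') = (i == i').
Proof.
apply/eqP/eqP => [/rowP/(_ i)|->//]; rewrite !mxE !eqxx /=.
by case: eqP.
Qed.

Lemma eps_neq_opp (i i' : 'I_w) : (- eps i == eps i' :> 'rV[int]_w)%R = false.
Proof.
by apply/eqP => /rowP/(_ i); rewrite !mxE !eqxx /=; case: eqP.
Qed.

Lemma follows_top T t j : follows T t -> star_word mu t ->
  eps_w_step T j = is_top (tnth t j).
Proof.
move=> fT st; rewrite /eps_w_step (step_move _ fT st) /is_top.
case: (tnth t j) => [[i u] b] /=; case: u => /=.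
  apply/existsP/idP => [[k /andP[kw]]|iw]; first by rewrite eps_inj => /eqP->.
  by exists i; rewrite iw eqxx.
by apply/existsP => -[k]; rewrite eps_neq_opp andbF.
Qed.

Lemma follows_vt T t : follows T t -> star_word mu t -> is_vt mu (ones w 0) T.
Proof.
move=> fT st; apply/and4P; split.
- apply/forallP => i; case: (unliftP ord0 i) => [j ->|->]; last by rewrite fT.1.
  by rewrite -[lift _ _]/(step_tgt j) fT.2; case/and3P: (follows_legal j fT st).
- by rewrite fT.1.
- rewrite (followsE _ fT) take_oversize ?size_tuple //.
  by rewrite (star_word_end st).
- apply/forallP => j; rewrite /allowed_step (step_move _ fT st); apply/orP; right.
  by apply/existsP; exists (tnth t j).1.1; case: ifP; rewrite eqxx ?orbT.
Qed.

Lemma follows_starred T t : follows T t -> star_word mu t ->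
  starred T [set j | (tnth t j).2].
Proof.
move=> fT st; apply/andP; split; apply/forallP => j.
  rewrite (step_move _ fT st); apply/eqP => /rowP/(_ (tnth t j).1.1).
  by case: ifP => _; rewrite !mxE !eqxx.
apply/implyP; rewrite inE => mk; have /and3P[_ _ /implyP/(_ mk)/andP[tp z]] := follows_legal j fT st.
rewrite (follows_top _ fT st) tp; apply/existsP; exists (tnth t j).1.1.
by rewrite z andbT; case/andP: tp.
Qed.

(** A nonzero allowed step is some [eps i] or its opposite, which gives the letter; the mark is read
    off [S]. *)
Lemma starred_word T S : is_vt mu (ones w 0) T -> starred T S ->
  exists t, [/\ follows T t, star_word mu t & [set j | (tnth t j).2] = S].
Proof.
case/and4P=> /forallP pT /eqP T0 /eqP Tn /forallP aT /andP[/forallP nz /forallP mkS].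
have epsE (i k : 'I_w) : eps i ord0 k = Posz (k == i) by rewrite mxE eqxx /=; case: eqP.
have rowE (u u' : 'rV[nat]_w) : (forall k, u ord0 k = u' ord0 k) -> u = u'.
  by move=> uu; apply/rowP.
have add_of j i : step T j = eps i -> T (step_tgt j) = add_cell (T (step_src j)) i.
  move=> e; apply: rowE => k; have := congr1 (fun u : 'rV[int]_w => u ord0 k) e.
  by rewrite epsE !mxE; case: (k == i); lia.
have del_of j i : step T j = (- eps i)%R ->
    T (step_tgt j) = del_cell (T (step_src j)) i /\ 0 < T (step_src j) ord0 i.
  move=> e; have eN k : step T j ord0 k = (- Posz (k == i))%R by rewrite e mxE epsE.
  split; last by have := eN i; rewrite !mxE eqxx; lia.
  by apply: rowE => k; have := eN k; rewrite !mxE; case: (k == i); lia.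
have ex (j : 'I_n) : exists l : letter, [/\ T (step_tgt j) = move (T (step_src j)) l,
    legal (T (step_src j)) l & l.2 = (j \in S)].
  have [jS|jS] := boolP (j \in S).
    have := mkS j; rewrite jS => /andP[/existsP[i /andP[iw /eqP si]] /existsP[k /andP[kw k0]]].
    have ki : k = i by apply: val_inj; apply: succn_inj; rewrite (eqP kw) (eqP iw).
    exists (i, true, true); split=> //=; first exact: add_of.
    by rewrite /legal /is_top /move /= -(add_of _ _ si) pT iw -ki k0.
  have := aT j; rewrite /allowed_step (negPf (nz j)) => /existsP[i /orP[]/eqP si].
    exists (i, true, false); split=> //; first exact: add_of.
    by rewrite /legal /move /= -(add_of _ _ si) pT.
  have [e p] := del_of _ _ si.
  by exists (i, false, false); split=> //; rewrite /legal /move /= -e pT p.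
have [f fP] := fin_all_exists ex.
pose t := [tuple f j | j < n]; have tE j : tnth t j = f j by rewrite tnth_mktuple.
have fT : follows T t by split=> // j; rewrite tE; case: (fP j).
exists t; split=> //; last by apply/setP => j; rewrite inE tE; case: (fP j).
have fin : foldl (@move w) mu t = ones w 0.
  by rewrite -Tn (followsE _ fT) take_oversize ?size_tuple.
case: (posnP n) => n0; last first.
  apply/(star_wordP (f (Ordinal n0))); split=> // i; rewrite size_tuple => ni.
  have := fP (Ordinal ni); rewrite -tE => -[_ + _].
  by rewrite (followsE _ fT) (tnth_nth (f (Ordinal n0))).
by rewrite (tuple_nil n0 t) /= in fin *; rewrite fin.
Qed.

(** [inord] maps into the finite carrier; on the words with [star_word mu t] it loses nothing, by
    [is_vt_bounded]. *)
Definition encode t : vt_seq n mu * {set 'I_n} :=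
  ([ffun i : 'I_n.+1 => map_mx inord (foldl (@move w) mu (take i t))],
   [set j | (tnth t j).2]).

Lemma traj_follows t : follows (fun i : 'I_n.+1 => foldl (@move w) mu (take i t)) t.
Proof.
split=> [|j]; first by rewrite /= take0.
pose l0 := tnth t j.
by rewrite /= /bump add1n (take_nth l0) ?size_tuple // -cats1 foldl_cat (tnth_nth l0).
Qed.

Lemma encode_follows t : star_word mu t -> follows (nat_seq (encode t).1) t.
Proof.
move=> st; have E i : nat_seq (encode t).1 i = foldl (@move w) mu (take i t).
  apply/rowP => k; rewrite /nat_seq /= ffunE !mxE inordK //.
  by rewrite ltnS (is_vt_bounded _ _ (follows_vt (traj_follows t) st)).
have [f0 fj] := traj_follows t.
by split=> [|j]; rewrite !E ?f0 ?fj.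
Qed.

Lemma encode_inj : {in [set t : n.-tuple letter | star_word mu t] &, injective encode}.
Proof.
move=> t t'; rewrite !inE => st st' e.
have ft := encode_follows st; have ft' := encode_follows st'; rewrite -e in ft'.
apply: eq_from_tnth => j; apply: (@move_eq _ (nat_seq (encode t).1 (step_src j))).
- exact: follows_legal.
- exact: follows_legal.
- by have := congr1 snd e => /setP/(_ j); rewrite !inE.
by rewrite -ft.2 -ft'.2.
Qed.

Lemma MVTstar_encode :
  MVTstar n w mu (ones w 0) = encode @: [set t : n.-tuple letter | star_word mu t].
Proof.
apply/setP => -[T S]; apply/idP/imsetP => [|[t]]; last first.
  rewrite inE => st ->; have ft := encode_follows st.
  by rewrite !inE (follows_vt ft st) (follows_starred ft st).
rewrite !inE => /andP[/= vt sS]; have [t [fT st SE]] := starred_word vt sS.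
exists t; first by rewrite inE.
congr pair; last by rewrite SE.
apply/ffunP => i; rewrite ffunE -(followsE i fT); apply/rowP => k.
by rewrite /nat_seq !mxE inord_val.
Qed.

Lemma first_unmarked T t : follows T t -> star_word mu t ->
  zero_word mu t =
  [forall j, ~~ eps_w_step T j]
  || [exists j, first_eps_w_step T j && (j \notin [set j | (tnth t j).2])].
Proof.
move=> fT st; have tp j := follows_top j fT st.
have [/forallP non|] := boolP [forall j, ~~ eps_w_step T j].
  have [n0|n0] := posnP n.
    by rewrite (tuple_nil n0 t) in st *.
  apply/(zero_wordP (tnth t (Ordinal n0))); split=> // i; rewrite size_tuple => ni ti.
  by have := non (Ordinal ni); rewrite tp (tnth_nth (tnth t (Ordinal n0))) ti.
rewrite negb_forall => /existsP[j0]; rewrite negbK => tj0.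
case: (arg_minnP (fun j : 'I_n => j : nat) tj0) => j tj min; pose l0 := tnth t j.
have fj : first_eps_w_step T j.
  rewrite /first_eps_w_step tj; apply/forallP => i; apply/implyP; apply: contraL => ti.
  by rewrite -leqNgt min.
have minT k : k < j -> ~~ is_top (nth l0 t k).
  move=> kj; have kn : k < n by apply: ltn_trans (ltn_ord j).
  have /andP[_ /forallP/(_ (Ordinal kn))/implyP/(_ kj)] := fj.
  by rewrite tp (tnth_nth l0).
rewrite /=; apply/(zero_wordP l0)/existsP => [[_ H]|[i /andP[fi]]].
  exists j; rewrite fj inE (tnth_nth l0); apply: H => //; first by rewrite size_tuple.
  by rewrite -tnth_nth -tp.
rewrite inE => mi; split=> // k; rewrite size_tuple => kn tk kk.
suff -> : k = i by rewrite -tnth_nth.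
case/andP: fi => ti /forallP fi.
case: (ltngtP k i) => // ki.
  by have := implyP (fi (Ordinal kn)) ki; rewrite tp (tnth_nth l0) tk.
by have := kk i ki; rewrite -tnth_nth -tp ti.
Qed.

Lemma MVT0_encode :
  MVT0 n w mu (ones w 0) = encode @: [set t : n.-tuple letter | zero_word mu t].
Proof.
apply/setP => P; rewrite [LHS]inE MVTstar_encode.
apply/andP/imsetP => [[/imsetP[t]]|[t]]; rewrite inE.
  move=> st -> H; exists t => //; rewrite inE.
  by rewrite (first_unmarked (encode_follows st) st).
move=> zt ->; have st := zero_word_star zt; split; first by apply: imset_f; rewrite inE.
by rewrite -(first_unmarked (encode_follows st) st).
Qed.

Lemma card_MVTstar : #|MVTstar n w mu (ones w 0)| = star_count n mu.
Proof. by rewrite MVTstar_encode card_in_imset ?star_countE //; exact: encode_inj. Qed.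

Lemma card_MVT0 : #|MVT0 n w mu (ones w 0)| = zero_count n mu.
Proof.
rewrite MVT0_encode card_in_imset ?zero_countE // => t t'; rewrite !inE => zt zt'.
by apply: encode_inj; rewrite inE zero_word_star.
Qed.

(** The first [eps_w] step is unique; its mark decides between the two sets, and walks without such
    a step belong to [MVT0]. *)
Lemma card_MVT0_MVT1 :
  #|MVT0 n w mu (ones w 0)| + #|MVT1 n w mu (ones w 0)| = #|MVTstar n w mu (ones w 0)|.
Proof.
rewrite -cardsUI [X in _ + X](_ : _ = 0) ?addn0.
  congr (#|pred_of_set _|); apply/setP => P; rewrite !inE -andb_orr.
  case: (_ && starred _ _) => //=.
  have [//|] := boolP [forall j, ~~ eps_w_step _ j].
  rewrite negb_forall => /existsP[j0]; rewrite negbK => tj0 /=.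
  case: (arg_minnP (fun j : 'I_n => j : nat) tj0) => j tj min.
  have fj : first_eps_w_step (nat_seq P.1) j.
    rewrite /first_eps_w_step tj; apply/forallP => i; apply/implyP; apply: contraL => ti.
    by rewrite -leqNgt min.
  have [jP|jP] := boolP (j \in P.2); apply/orP; [right | left];
    by apply/existsP; exists j; rewrite fj jP.
apply: eq_card0 => P; rewrite !inE; apply/negP => /andP[/andP[_ A] /andP[_ /existsP[j /andP[fj jP]]]].
case/orP: A => [/forallP/(_ j)|/existsP[i /andP[fi iP]]]; first by case/andP: fj => ->.
suff ij : i = j by rewrite -ij (negPf iP) in jP.
move: fi fj => /andP[ti /forallP fi] /andP[tj /forallP fj].
apply: val_inj; case: (ltngtP i j) => // h.
  by have := implyP (fj i) h; rewrite ti.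
by have := implyP (fi j) h; rewrite tj.
Qed.

End WalkWords.

(** * Standard Young tableaux as column words *)

Section ColumnWords.
Variables (m k : nat).
Implicit Types (la : 'rV[nat]_m) (s : seq 'I_m).

Fixpoint col_word la s :=
  if s is j :: s' then is_partition (add_cell la j) && col_word (add_cell la j) s'
  else #|odd_set la| == k.

Lemma add_countE n la : add_count n la k = #|[set u : n.-tuple 'I_m | col_word la u]|.
Proof.
elim: n la => [|n IHn] la; first by rewrite (card_tuple0 (col_word la)).
rewrite (card_tuple_cons _ (col_word la)) /= big_mkcond /=; apply: eq_bigr => j _.
case: ifP => pj /=; first by rewrite IHn.
by apply/esym/eq_card0 => t; rewrite inE.
Qed.

Lemma foldl_add_cell la s c :
  foldl (@add_cell m) la s ord0 c = la ord0 c + count_mem (c : nat) (map val s).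
Proof.
elim: s la => [|j s IHs] la /=; first by rewrite addn0.
by rewrite IHs mxE -addnA eq_sym.
Qed.

Lemma col_wordP la s :
  reflect ((forall i, 0 < i <= size s -> is_partition (foldl (@add_cell m) la (take i s)))
           /\ #|odd_set (foldl (@add_cell m) la s)| = k) (col_word la s).
Proof.
elim: s la => [|j s IHs] la /=.
  by apply: (iffP eqP) => [kE|[]] //; split=> // i; case: i.
apply: (iffP andP) => [[pj /IHs[H kE]]|[H kE]].
  split=> // -[|[|i]] //= si; first by rewrite take0.
  by apply: (H i.+1).
split; first by have := H 1 isT; rewrite /= take0.
by apply/IHs; split=> // i /andP[i0 si]; apply: (H i.+1).
Qed.

End ColumnWords.

(** The Yamanouchi condition on prefixes. For [i] beyond the length, [take] returns the whole
    word. *)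
Definition lattice_word (s : seq nat) : Prop :=
  forall i c d, c <= d -> count_mem d (take i s) <= count_mem c (take i s).

Lemma col_word_lattice m k (s : seq 'I_m) :
  col_word k (ones m 0) s <->
  lattice_word (map val s) /\
  #|[set c : 'I_m | odd (count_mem (c : nat) (map val s))]| = k.
Proof.
have oE : odd_set (foldl (@add_cell m) (ones m 0) s) =
    [set c : 'I_m | odd (count_mem (c : nat) (map val s))].
  by apply/setP => c; rewrite !inE foldl_add_cell ones0E.
have out (r : seq 'I_m) d : m <= d -> count_mem d (map val r) = 0.
  move=> md; apply/count_memPn/mapP => -[c _ dc]; have := ltn_ord c.
  by rewrite -[nat_of_ord c]/(val c) -dc ltnNge md.
split=> [/col_wordP[H kE]|[H kE]]; last first.
  apply/col_wordP; rewrite oE; split=> // i _; apply/partitionP => c d cd.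
  by rewrite !foldl_add_cell !ones0E !add0n !map_take; apply: H.
rewrite oE in kE; split=> // i c d cd; case: (ltnP d m) => dm; last first.
  by rewrite -map_take out.
have cm := leq_ltn_trans cd dm.
(* [col_wordP] speaks of nonempty prefixes within the word; the empty prefix and larger [i] are
   reduced separately. *)
case: (posnP i) => [->|i0]; first by rewrite take0.
wlog si : i i0 / i <= size s.
  move=> W; case: (leqP i (size s)) => [/(W _ i0)//|/ltnW si].
  case: (posnP (size s)) => [/size0nil-> //|s0].
  by have := W _ s0 (leqnn _); rewrite !take_oversize ?size_map.
have /partitionP/(_ (Ordinal cm) (Ordinal dm) cd) : is_partition
  (foldl (@add_cell m) (ones m 0) (take i s)) by apply: H; rewrite i0.
by rewrite !foldl_add_cell !ones0E !add0n -!map_take.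
Qed.

Section Occurrences.
Implicit Types s : seq nat.

Lemma count_take_lt s e e' :
  e < e' -> e < size s -> count_mem (nth 0 s e) (take e s) < count_mem (nth 0 s e) (take e' s).
Proof.
move=> ee es; have [q ->] : exists q, e' = e.+1 + q by exists (e' - e.+1); lia.
by rewrite takeD count_cat (take_nth 0) // -cats1 count_cat /= eqxx addn0 addn1 ltnS leq_addr.
Qed.

Lemma count_take_le s c i i' : i <= i' -> count_mem c (take i s) <= count_mem c (take i' s).
Proof. by move=> /subnKC<-; rewrite takeD count_cat leq_addr. Qed.

(** This locates occurrence number [r], counted from 0: the entry in row [r] of column [c]. *)
Lemma occurrence s c r : r < count_mem c s ->
  exists e, [/\ e < size s, nth 0 s e = c & count_mem c (take e s) = r].
Proof.
elim/last_ind: s => // s a IHs; rewrite -cats1 count_cat /= addn0 size_cat addn1.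
case: (ltnP r (count_mem c s)) => [rs _|sr rlt].
  have [e [es ec er]] := IHs rs; exists e.
  by rewrite nth_cat es takel_cat ?(ltnW es) // ltnS ltnW.
exists (size s); rewrite ltnSn nth_cat ltnn subnn take_size_cat //=.
move: rlt; case: (a =P c) => [->|_] /= rlt; last by rewrite addn0 ltnNge sr in rlt.
by split=> //; apply/eqP; rewrite eqn_leq sr; rewrite addn1 ltnS in rlt.
Qed.

End Occurrences.

(** * Lattice words and standard fillings *)

Section Fillings.
Variables (n m : nat).
Implicit Types (u : n.-tuple 'I_m) (t : filling n) (e : 'I_n) (x : 'I_n * 'I_n).

Definition word u : seq nat := map val u.
(** Entry [e] goes below the earlier entries of its column, so its row is their number. *)
Definition row_of u e : nat := count_mem (nth 0 (word u) e) (take e (word u)).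
Definition fill u : filling n :=
  [ffun x : 'I_n * 'I_n => [pick e : 'I_n | (row_of u e == x.1 :> nat) && (nth 0 (word u) e == x.2 :> nat)]].

Lemma size_word u : size (word u) = n.
Proof. by rewrite size_map size_tuple. Qed.

Lemma nth_word u e : nth 0 (word u) e = tnth u e.
Proof. by rewrite (nth_map (tnth u e)) ?size_tuple // -tnth_nth. Qed.

Lemma cell_inj u e e' : row_of u e = row_of u e' ->
  nth 0 (word u) e = nth 0 (word u) e' -> e = e'.
Proof.
rewrite /row_of => + ce; rewrite -ce => re; apply: val_inj.
case: (ltngtP e e') => // h.
  have := @count_take_lt (word u) e e' h; rewrite size_word re.
  by move=> /(_ (ltn_ord e)); rewrite ltnn.
have := @count_take_lt (word u) e' e h; rewrite size_word -ce re.
by move=> /(_ (ltn_ord e')); rewrite ltnn.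
Qed.

Lemma fillE u x e : fill u x = Some e <->
  row_of u e = x.1 /\ nth 0 (word u) e = x.2.
Proof.
rewrite ffunE; case: pickP => [e' /andP[/eqP re /eqP ce]|no]; split.
- by case=> <-.
- by case=> re' ce'; congr Some; apply: (@cell_inj u); rewrite ?re ?re' ?ce ?ce'.
- by [].
- by case=> re ce; have := no e; rewrite re ce !eqxx.
Qed.

Section LatticeFilling.
Variable u : n.-tuple 'I_m.
Hypothesis lat : lattice_word (word u).

(** A lattice word using [c] uses all smaller letters, hence has at least [c + 1] positions. So the
    tableau fits in the [n] by [n] grid. *)
Lemma lattice_col_bound c : 0 < count_mem c (word u) -> c < n.
Proof.
move=> c0; have le d : d <= c -> d \in word u.
  move=> dc; rewrite -has_pred1 has_count; apply: leq_trans c0 _.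
  by have := lat n dc; rewrite take_oversize // size_word.
rewrite -(size_word u) -(size_iota 0 c.+1); apply: uniq_leq_size (iota_uniq _ _) _.
by move=> d; rewrite mem_iota => /andP[_ dc]; apply: le.
Qed.

Lemma cell_exists e : exists x, fill u x = Some e.
Proof.
have ru : row_of u e < n.
  apply: leq_ltn_trans (count_size _ _) _.
  by rewrite size_take size_word ltn_ord.
have cu : nth 0 (word u) e < n.
  apply: lattice_col_bound; rewrite -has_count has_pred1 mem_nth // size_word //.
by exists (Ordinal ru, Ordinal cu); apply/fillE.
Qed.

Lemma mem_shape_fill x : (x \in Defs.shape (fill u)) = (x.1 < count_mem (x.2 : nat) (word u)).
Proof.
rewrite inE; apply/idP/idP => [|/occurrence[e []]].
  case E : (fill u x) => [e|] // _; have [<- <-] := (fillE u x e).1 E.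
  have := @count_take_lt (word u) e n; rewrite size_word (take_oversize (n := n)) ?size_word //.
  by apply.
rewrite size_word => en ec er.
suff -> : fill u x = Some (Ordinal en) by [].
by apply/fillE; rewrite /row_of /= ec er.
Qed.

Lemma col_length_fill (c : 'I_n) : col_length (Defs.shape (fill u)) c = count_mem (c : nat) (word u).
Proof.
set C := count_mem _ _; have Cn : C <= n by rewrite -(size_word u) count_size.
rewrite /col_length (_ : [set r | _] = [set widen_ord Cn i | i : 'I_C]).
  by rewrite card_imset ?card_ord // => i j [] /val_inj.
apply/setP => r; rewrite inE mem_shape_fill /=; apply/idP/imsetP => [rC|[i _ ->]].
  by exists (Ordinal rC) => //; apply: val_inj.
exact: (ltn_ord i).
Qed.

(** One count runs over the [n] grid columns, the other over the [m] letters; both are compared with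
    [n + m] columns, the surplus ones being empty. *)
Lemma num_odd_fill : num_odd_cols (Defs.shape (fill u)) =
  #|[set c : 'I_m | odd (count_mem (c : nat) (word u))]|.
Proof.
pose F c : nat := odd (count_mem c (word u)).
have F0 c : (n <= c) || (m <= c) -> F c = 0.
  move=> h; rewrite /F; suff -> : count_mem c (word u) = 0 by [].
  case/orP: h => h; last first.
    apply/count_memPn/mapP => -[j _ cj]; have := ltn_ord j.
    by rewrite -[nat_of_ord j]/(val j) -cj ltnNge h.
  by apply/eqP; rewrite -leqn0 leqNgt; apply: contraL h => /lattice_col_bound; rewrite -ltnNge.
have sumF p q : (forall c, p <= c -> F c = 0) -> \sum_(c < p) F c = \sum_(c < p + q) F c.
  move=> Fp; rewrite big_split_ord /= [X in _ + X]big1 ?addn0 // => i _.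
  by rewrite Fp // leq_addr.
transitivity (\sum_(c < n) F c).
  rewrite /num_odd_cols -sum1_card big_mkcond /=; apply: eq_bigr => c _.
  by rewrite inE col_length_fill /F; case: odd.
rewrite (sumF n m); last by move=> c nc; rewrite F0 ?nc.
rewrite addnC -(sumF m n); last by move=> c nc; rewrite F0 ?nc ?orbT.
rewrite -sum1_card [RHS]big_mkcond /=; apply: eq_bigr => c _.
by rewrite inE /F; case: odd.
Qed.

Lemma num_cols_fill : num_cols (Defs.shape (fill u)) <= m.
Proof.
rewrite /num_cols cardE -(size_map val) -[X in _ <= X](size_iota 0).
apply: uniq_leq_size => [|c /mapP[d]].
  by rewrite map_inj_uniq ?enum_uniq //; apply: val_inj.
rewrite mem_enum inE col_length_fill -has_count has_pred1 => /mapP[j _ dj] ->.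
by rewrite mem_iota -[val d]/(nat_of_ord d) dj /= ltn_ord.
Qed.

Lemma fill_syt : is_syt (fill u).
Proof.
apply/and4P; split.
- apply/forallP => x; apply/implyP => xD; apply/forallP => y; apply/implyP => /andP[y1 y2].
  move: xD; rewrite !mem_shape_fill => xD; apply: leq_ltn_trans y1 (leq_trans xD _).
  by have := lat n y2; rewrite !take_oversize ?size_word.
- apply/forallP => e; have [x xe] := cell_exists e; apply/eqP.
  rewrite (_ : [set _ | _] = [set x]) ?cards1 //; apply/setP => y; rewrite !inE.
  apply/eqP/eqP => [/fillE[ye1 ye2]|->//]; have [xe1 xe2] := (fillE u x e).1 xe.
  by apply/eqP; rewrite -pair_eqE /= -!val_eqE /= -ye1 -ye2 xe1 xe2 !eqxx.
- apply/forallP => r; apply/forallP => c; apply/forallP => d; apply/implyP => cd.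
  rewrite /entry_lt; case E : (fill u (r, c)) => [e|//]; case E' : (fill u (r, d)) => [e'|//].
  have [/= re ce] := (fillE u _ e).1 E; have [/= re' ce'] := (fillE u _ e').1 E'.
  rewrite ltnNge; apply/negP => e'e.
  have e'lt : e' < e.
    rewrite ltn_neqAle e'e andbT; apply: contraTneq cd => /val_inj eE.
    by rewrite -ce -ce' eE ltnn.
  (* If [e'] came first, the prefix through [e'] would contain [d] more than [r] times but [c] at
     most [r] times. *)
  have h1 := lat e'.+1 (ltnW cd).
  have h2 := @count_take_lt (word u) e' e'.+1 (ltnSn _); rewrite size_word in h2.
  have h3 := @count_take_le (word u) c _ _ e'lt.
  have {}h2 := h2 (ltn_ord e'); move: re re' h2; rewrite /row_of ce ce'; lia.
- apply/forallP => c; apply/forallP => r; apply/forallP => r'; apply/implyP => rr.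
  rewrite /entry_lt; case E : (fill u (r, c)) => [e|//]; case E' : (fill u (r', c)) => [e'|//].
  have [/= re ce] := (fillE u _ e).1 E; have [/= re' ce'] := (fillE u _ e').1 E'.
  rewrite ltnNge; apply/negP => e'e; have h := @count_take_le (word u) c _ _ e'e.
  by move: re re'; rewrite /row_of ce ce'; lia.
Qed.

End LatticeFilling.

Lemma fill_inj u u' : lattice_word (word u) -> fill u = fill u' -> u = u'.
Proof.
move=> lat e; apply: eq_from_tnth => i; have [x xi] := cell_exists lat i.
apply: val_inj; rewrite /= -!nth_word.
have [_ ->] := (fillE u x i).1 xi.
by rewrite e in xi; have [_ ->] := (fillE u' x i).1 xi.
Qed.

Section WordOfTableau.
Variable t : filling n.
Hypothesis tP : is_syt t.

Lemma syt_diagram x (y : 'I_n * 'I_n) : t x != None -> y.1 <= x.1 -> y.2 <= x.2 -> t y != None.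
Proof.
case/and4P: tP => /forallP dg _ _ _ xD y1 y2.
have := dg x; rewrite inE xD => /forallP/(_ y); rewrite y1 y2 /=.
by rewrite inE.
Qed.

Lemma syt_cell e : exists x, forall y, (t y == Some e) = (y == x).
Proof.
case/and4P: tP => _ /forallP/(_ e)/cards1P[x xE] _ _; exists x => y.
by have /setP/(_ y) := xE; rewrite !inE.
Qed.

Lemma syt_row r (c d : 'I_n) e e' : t (r, c) = Some e -> t (r, d) = Some e' -> c < d -> e < e'.
Proof.
move=> te te' cd; case/and4P: tP => _ _ /forallP/(_ r)/forallP/(_ c)/forallP/(_ d) + _.
by rewrite cd /entry_lt te te'.
Qed.

Lemma syt_col c (r s : 'I_n) e e' : t (r, c) = Some e -> t (s, c) = Some e' -> r < s -> e < e'.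
Proof.
move=> te te' rs; case/and4P: tP => _ _ _ /forallP/(_ c)/forallP/(_ r)/forallP/(_ s).
by rewrite rs /entry_lt te te'.
Qed.

Lemma syt_col_bound x : num_cols (Defs.shape t) <= m -> t x != None -> x.2 < m.
Proof.
move=> nm tx; apply: leq_trans nm; rewrite /num_cols.
have xn : x.2 < n by [].
have -> : x.2.+1 = #|[set widen_ord xn i | i : 'I_x.2.+1]|.
  by rewrite card_imset ?card_ord // => i j [] /val_inj.
apply/subset_leq_card/subsetP => _ /imsetP[i _ ->]; rewrite inE card_gt0.
apply/set0Pn; exists x.1; rewrite !inE; apply: (syt_diagram tx) => //=.
by rewrite -ltnS.
Qed.

Variable u : n.-tuple 'I_m.
Variable cell : 'I_n -> 'I_n * 'I_n.
Hypothesis cellP : forall e y, (t y == Some e) = (y == cell e).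
Hypothesis uP : forall e, tnth u e = (cell e).2 :> nat.

Lemma t_cell e : t (cell e) = Some e.
Proof. by apply/eqP; rewrite cellP. Qed.

Lemma cell_ofE e x : t x = Some e -> cell e = x.
Proof. by move=> tx; apply/esym/eqP; rewrite -cellP tx. Qed.

(** Strong induction on the entry. If the count were too small, the cell of the column at that
    height would hold a smaller entry with the same count; if too large, an earlier entry would
    already occupy the cell of [e]. *)
Lemma row_of_cell e : row_of u e = (cell e).1.
Proof.
case: e => e; elim/ltn_ind: e => e IH en; set E := Ordinal en.
have cE := nth_word u E; rewrite uP /= in cE.
case: (ltngtP (row_of u E) (cell E).1) => // h; exfalso.
  have rn : row_of u E < n by apply: ltn_trans h (ltn_ord _).
  have: t (Ordinal rn, (cell E).2) != None.
    by apply: (@syt_diagram (cell E)); rewrite ?t_cell //= ltnW.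
  case te : (t _) => [e'|//] _; have e'E : e' < e.
    have tE : t ((cell E).1, (cell E).2) = Some E by rewrite -surjective_pairing t_cell.
    exact: (syt_col te tE h).
  have := IH e' e'E (ltn_ord e'); rewrite (_ : Ordinal _ = e'); last exact: val_inj.
  rewrite (cell_ofE te) /= => re'; have ce' := nth_word u e'; rewrite uP (cell_ofE te) /= in ce'.
  have := @count_take_lt (word u) e' E e'E; rewrite size_word => /(_ (ltn_ord e')).
  by rewrite -/(row_of u e') re' /row_of ce' cE ltnn.
have [e' [es ec er]] := occurrence h.
rewrite size_take size_word ltn_ord in es.
have e'n : e' < n := ltn_trans es en.
have ec' : nth 0 (word u) e' = nth 0 (word u) E by rewrite -ec nth_take.
have re' : row_of u (Ordinal e'n) = (cell E).1.
  by rewrite /row_of /= ec' -er take_takel // ltnW.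
have := IH e' es e'n; rewrite re' => r1.
have c1 : (cell (Ordinal e'n)).2 = (cell E).2 :> nat.
  by rewrite -!uP -!nth_word /= ec'.
have : cell (Ordinal e'n) = cell E.
  by apply/eqP; rewrite -pair_eqE /= -!val_eqE /= -r1 c1 !eqxx.
move=> ceq; have := t_cell (Ordinal e'n); rewrite ceq t_cell => -[ee].
by rewrite -ee ltnn in es.
Qed.

Lemma fill_cell : fill u = t.
Proof.
apply/ffunP => x; case tx : (t x) => [e|].
  by apply/fillE; rewrite row_of_cell nth_word uP (cell_ofE tx).
case fx : (fill u x) => [e|//]; have [] := (fillE u x e).1 fx.
rewrite row_of_cell nth_word uP => /val_inj r /val_inj c.
have := t_cell e; rewrite (_ : cell e = x) ?tx //.
by rewrite [LHS]surjective_pairing [RHS]surjective_pairing r c.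
Qed.

(** If [d] has occurred [k + 1] times, row [k] is filled in column [d]. The cell of that row in
    column [c], weakly to the left, has a weakly smaller entry, so [c] has occurred [k + 1] times as
    well. *)
Lemma word_lattice : lattice_word (word u).
Proof.
move=> i c d cd; case: (posnP (count_mem d (take i (word u)))) => [->//|].
case K : (count_mem _ _) => [//|k] _.
have := @occurrence (take i (word u)) d k; rewrite K => /(_ (ltnSn _)) [e [es ed ek]].
rewrite size_take_min size_word ltn_min in es; case/andP: es => ei en.
rewrite nth_take // in ed; rewrite take_takel ?(ltnW ei) // in ek.
pose E := Ordinal en.
have rE : (cell E).1 = k :> nat by rewrite -row_of_cell /row_of /= ed.
have cE : (cell E).2 = d :> nat by rewrite -uP -nth_word.
have cn : c < n by apply: leq_ltn_trans cd _; rewrite -cE.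
have: t ((cell E).1, Ordinal cn) != None.
  by apply: (@syt_diagram (cell E)); rewrite ?t_cell //= cE.
case te : (t _) => [e'|//] _.
have e'E : e' <= e.
  rewrite leq_eqVlt in cd; case/orP: cd => [/eqP cd|cd].
    have te2 : t (cell E) = Some e'.
      rewrite -te [cell E in LHS]surjective_pairing (_ : (cell E).2 = Ordinal cn) //.
      by apply: val_inj; rewrite /= cE.
    by move: te2; rewrite t_cell => -[<-].
  have tE : t ((cell E).1, (cell E).2) = Some E by rewrite -surjective_pairing t_cell.
  by apply/ltnW/(syt_row te tE); rewrite cE.
have re' : row_of u e' = k by rewrite row_of_cell (cell_ofE te).
have ce' : nth 0 (word u) e' = c by rewrite nth_word uP (cell_ofE te).
rewrite -re' /row_of ce'; apply: leq_trans (_ : count_mem c (take e'.+1 (word u)) <= _).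
  have := @count_take_lt (word u) e' e'.+1 (ltnSn _); rewrite size_word ce'.
  exact.
by apply: count_take_le; apply: leq_ltn_trans e'E ei.
Qed.

End WordOfTableau.

End Fillings.

Lemma card_SYT n m k : #|SYT n m k| = add_count n (ones m 0) k.
Proof.
rewrite add_countE.
have -> : SYT n m k = @fill n m @: [set u : n.-tuple 'I_m | col_word k (ones m 0) u].
  apply/setP => t; rewrite inE; apply/and3P/imsetP => [[tP tm /eqP tk]|[u]]; last first.
    rewrite inE => /col_word_lattice[lat uk] ->.
    by rewrite fill_syt // num_cols_fill // num_odd_fill // uk.
  have [cell cellP] := fin_all_exists (syt_cell tP).
  have ex e : exists c : 'I_m, c = (cell e).2 :> nat.
    have cm : (cell e).2 < m.
      by apply: (syt_col_bound tP tm); rewrite (eqP (_ : t _ == Some e)) ?cellP.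
    by exists (Ordinal cm).
  have [f fP] := fin_all_exists ex; pose u := [tuple f e | e < n].
  have uP e : tnth u e = (cell e).2 :> nat by rewrite tnth_mktuple.
  have lat := word_lattice tP cellP uP.
  exists u; last by rewrite (fill_cell tP cellP uP).
  rewrite inE; apply/col_word_lattice; split=> //.
  by rewrite -num_odd_fill // (fill_cell tP cellP uP).
by rewrite card_in_imset // => u u'; rewrite !inE => /col_word_lattice[lat _] _ /(fill_inj lat).
Qed.

(** * Combination of the orthogonal and symplectic identities *)

Theorem theorem8p7 (n w k : nat) (hk : k <= w) :
  (k < w ->
     [/\ #|SYT n (2 * w) k| = #|MVT0 n w (ones w k) (ones w 0)|,
         #|SYT n (2 * w) (2 * w - k)| = #|MVT1 n w (ones w k) (ones w 0)|
       & #|SYT n (2 * w) k| + #|SYT n (2 * w) (2 * w - k)|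
         = #|MVTstar n w (ones w k) (ones w 0)|])
  /\
  (k = w ->
     #|SYT n (2 * w) w| = #|MVTstar n w (ones w w) (ones w 0)|).
Proof.
have pk j : is_partition (ones w j) := ones_partition w j.
split=> [kw|_]; rewrite !card_SYT.
  have := card_MVT0_MVT1 n (ones w k).
  rewrite card_MVTstar // card_MVT0 //.
  have w0 : 0 < w by apply: leq_ltn_trans kw.
  have := orthogonal_coef n w0 hk; rewrite walk_count_star.
  (* For [k < w] the start [(1^k)] lies on the wall. *)
  rewrite (_ : wall_factor _ = 1) ?mul1n; last first.
    rewrite /wall_factor; case: existsP => // -[i /andP[/eqP iw]].
    by rewrite mxE; case: ifP => //; lia.
  case: w kw {hk pk w0} => // v kv D Z.
  have := @symplectic_coef n v k kv; have := zero_count_double n (ones v k).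
  rewrite extend_ones // => Z2 C.
  (* With [a, b] the two tableau counts, [a + b = star], [a - b = walk], [2 zero = star + walk] and
     [zero + |MVT1| = star] give all three claims. *)
  by split; lia.
rewrite card_MVTstar //; have [->|w0] := posnP w.
  case: n => [|n] /=; last by rewrite !big_ord0.
  rewrite (_ : odd_set _ = set0) ?cards0 ?eqxx //.
  by apply/setP => i; rewrite !inE mxE.
have := orthogonal_coef n w0 (leqnn w); rewrite walk_count_star.
have wl : w.-1 < w by lia.
(* The start [(1^w)] is off the wall, so the factor 2 cancels against the doubled tableau count. *)
rewrite (@wall_factorE _ _ (Ordinal wl)) /=; last by lia.
by rewrite mxE /= wl /= (_ : 2 * w - w = w); lia.
Qed.
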